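(* Let $r$ be a positive integer, let $q$ be a complex number with $0<|q|<1$, let $a,b,z$ be complex numbers (with $z\ne0$, $b\neq1$) such that $\max(|az|,|b|)<1$, and let $x_1,\dots,x_r$ be nonzero, pairwise distinct complex numbers. For $\mathbf k=(k_1,\dots,k_r)\in\mathbb Z^r$ write $|\mathbf k|=k_1+\dots+k_r$. Then \[ \frac{(z,q/z)_{\infty}}{1-b} \prod_{i,j=1}^{r}\Big(\frac{x_i}{x_j}q\Big)_{\infty} =\sum _{k_1,\dots,k_r=-\infty}^{\infty}\Bigg( \prod_{1\le i<j\le r}\frac {x_iq^{k_i}-x_jq^{k_j}}{x_i-x_j}\, \big(aq^{1-|\mathbf k|}+bq\big)_{\infty}\, \big(z(a+bq^{|\mathbf k|})\big)_{\infty} (-1)^{r|\mathbf k|}q^{r\sum_{i=1} ^{r}\binom{k_i}2} z^{|\mathbf k|}\prod_{i=1}^{r}x_i^{rk_i-|\mathbf k|} \Bigg), \] where the multiple series converges absolutely.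
   Context: For a complex number $x$, $(x)_\infty=(x;q)_\infty:=\prod_{j\ge0}(1-xq^j)$, and $(x_1,\dots,x_m)_\infty:=(x_1)_\infty\cdots(x_m)_\infty$. Here $(aq^{1-|\mathbf k|}+bq)_\infty$ means $\prod_{j\ge0}(1-(aq^{1-|\mathbf k|}+bq)q^j)$, and similarly for $(z(a+bq^{|\mathbf k|}))_\infty$. *)

(* Defs.v *)
From mathcomp Require Export all_boot all_order all_algebra.
From mathcomp Require Export finmap complex.
From mathcomp Require Export all_classical all_reals all_analysis.

Set Implicit Arguments.
Unset Strict Implicit.
Unset Printing Implicit Defensive.

Export Order.TTheory GRing.Theory Num.Theory.
Export numFieldNormedType.Exports.

Local Open Scope ring_scope.
Local Open Scope complex_scope.

(* R[i]^o carries the topology of the complex modulus; the limit exists whenever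
   `|q| < 1. *)
Definition qpoch {R : realType} (q x : R[i]) : R[i] :=
  limn (fun n : nat => \prod_(0 <= j < n) (1 - x * q ^+ j) : R[i]^o).

(* k (k - 1) is even, so the division is exact, also for k < 0. *)
Definition binz2 (k : int) : int := ((k * (k - 1)) %/ 2)%Z.

Definition ksum {r : nat} (k : {ffun 'I_r -> int}) : int := \sum_(i < r) k i.

Definition abs_summable {R : realType} {T : choiceType} (f : T -> R[i]) : Prop :=
  summable [set: T] (fun k => (Normc.normc (f k))%:E).

(* Convergence of the finite partial sums along finite subsets of T ordered by
   inclusion, i.e. the value of the series independently of any enumeration. *)
Definition sums_to {R : realType} {T : choiceType} (f : T -> R[i]) (S : R[i]) :
    Prop :=
  forall e : R, 0 < e ->
    exists A : {fset T}, forall B : {fset T}, (A `<=` B)%fset ->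
      Normc.normc (\sum_(k <- B) f k - S) < e.

(* Main.v *)
(* The q-Abel-Rothe identity expands (c)_n as a sum of terms c^k (c(a+bq^k))_(n-k)
   weighted by q-binomials. For x_i/x_j outside q^Z, Milne's finite A_(r-1)
   summation writes the q-binomial of rm over M as a sum over the k in the box
   [0,m]^r with |k| = M: partial fractions give it a two-term recurrence in M.
   Substituting the second into the first and recentring the box [0,2n]^r at the
   origin gives a finite bilateral identity. Its terms converge to those of the
   series and are dominated by C rho^(2 sum_i |k_i|) with rho < 1, since
   the weight factors as q^(|k| choose 2) times a product over pairs i < j of
   functions of k_i - k_j with Gaussian decay; so Tannery's theorem applies.
   If x_i = x_j q^l with i <> j, the product side vanishes, and exchanging
   x_i q^(k_i) and x_j q^(k_j) is an involution of the index set that changes the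
   sign of the summand. *)
Require Import Defs.
From mathcomp Require Import perm ring lra zify.

Set Implicit Arguments.
Unset Strict Implicit.
Unset Printing Implicit Defensive.

Local Open Scope ring_scope.
Local Open Scope complex_scope.

(** The finite identity is used with c = z q^(-L) and with a replaced by a q^L, where L = rn is half
    of the full degree 2rn. At |k| = L + N this turns c (a + b q^|k|) into z (a + b q^N) and the
    Abel-Rothe coefficient into (1 - a q^L - b) (a q^(1-N) + b q)_(L+N-1). In these factors L
    survives only in the lengths and in the prefactor, whose limit 1 - b explains the division by 1
    - b. The delicate direction is that of N. The Gaussian factor q^(N choose 2) is used up by the
    growth of (a q^(1-N) + b q) as N tends to +oo and of (z (a + b q^N)) as N tends to -oo; about
    |N| factors close to -az, respectively -b, remain. The decay in N is therefore only geometric,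
    and this is where max(|az|, |b|) < 1 enters. The differences k_i - k_j keep their Gaussian
    decay, which beats every geometric rate. Milne's summation divides by factors 1 - (x_i/x_j) q^s.
    The bounds divide only by x_i - x_j, so that they serve the generic and the degenerate case
    alike. *)

Definition qpn (F : comNzRingType) (q : F) (n : nat) (x : F) : F :=
  \prod_(j < n) (1 - x * q ^+ j).

(* [qbs q n k] is (-1)^k q^(k choose 2) times the Gaussian binomial [n, k]. *)
Definition qbs (F : fieldType) (q : F) (n k : nat) : F :=
  \prod_(t < k) ((q ^+ n - q ^+ t) / (1 - q ^+ t.+1)).

(** * The finite q-Abel-Rothe identity *)

Section AbelRothe.

Variables (F : fieldType) (q : F).
Hypotheses (q_neq0 : q != 0) (q_aper : forall n, 1 - q ^+ n.+1 != 0).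

Lemma qbs_small n k : (n < k)%N -> qbs q n k = 0.
Proof.
move=> ltnk; rewrite /qbs (bigD1 (Ordinal ltnk)) //=.
by rewrite subrr !mul0r.
Qed.

Lemma qbs0 n : qbs q n 0 = 1. Proof. by rewrite /qbs big_ord0. Qed.

Lemma qbsS n k :
  qbs q n.+1 k.+1 = qbs q n k.+1 - q ^+ n * qbs q n k.
Proof.
rewrite /qbs !prodf_div big_ord_recl [in RHS]big_ord_recr /=.
rewrite (eq_bigr (fun t : 'I_k => q * (q ^+ n - q ^+ t))); last first.
  by move=> t _; rewrite /bump leq0n add1n !exprS; ring.
rewrite big_split /= prodr_const card_ord big_ord_recr /= expr0.
have h1 : \prod_(i < k) (1 - q ^+ i.+1) != 0.
  by apply/prodf_neq0 => i _; exact: q_aper.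
have h2 := q_aper k; rewrite !exprS in h1 h2 *.
by field; rewrite h2 h1.
Qed.

(** Kept homogeneous: [y = 1] expands [qpn], while [rothe_coef_sum] applies it at [x = q] and
    [y = u k.+1]. *)
Lemma qbinomial n x y :
  \prod_(j < n) (y - x * q ^+ j) =
  \sum_(k < n.+1) qbs q n k * x ^+ k * y ^+ (n - k).
Proof.
elim: n => [|n IH]; first by rewrite big_ord0 big_ord1 qbs0 !mul1r.
rewrite big_ord_recr IH [RHS]big_ord_recl qbs0 /= mulrBr.
rewrite big_distrl /= big_distrl /=.
under [in RHS]eq_bigr => i _.
  rewrite /bump leq0n add1n qbsS mulrBl mulrBl; over.
rewrite big_split /= big_ord_recl /= qbs0.
rewrite [X in _ = _ + (X + _)]big_ord_recr /= qbs_small // !mul0r addr0.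
rewrite sumrN addrA; congr (_ + _ - _); last first.
  by apply: eq_bigr => i _; rewrite subSS exprS; ring.
  apply: eq_bigr => i _; rewrite /bump leq0n add1n -!mulrA -exprSr.
  by have -> : (n - i.+1).+1 = (n.+1 - i.+1)%N by have := ltn_ord i; lia.
by rewrite !subn0 exprSr; ring.
Qed.

Lemma qpnE n x : qpn q n x = \sum_(k < n.+1) qbs q n k * x ^+ k.
Proof.
by rewrite /qpn qbinomial; apply: eq_bigr => k _; rewrite expr1n mulr1.
Qed.

(* A polynomial of degree < m is killed by the m-th q-difference, because
   (q^(j+1-m))_m = 0 for j < m. *)
Lemma qdiff_poly m (p : {poly F}) : (size p <= m)%N ->
  \sum_(k < m.+1) qbs q m k * q ^- (k * m.-1) * p.[q ^+ k] = 0.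
Proof.
move=> szp.
have mono j : (j < m)%N ->
    \sum_(k < m.+1) qbs q m k * q ^- (k * m.-1) * (q ^+ k) ^+ j = 0.
  move=> ltjm.
  transitivity (qpn q m (q ^+ j / q ^+ m.-1)).
    rewrite qpnE; apply: eq_bigr => k _; rewrite -mulrA; congr (_ * _).
    by rewrite expr_div_n -!exprM mulrC (mulnC k) (mulnC k).
  have lt : (m.-1 - j < m)%N by lia.
  rewrite /qpn (bigD1 (Ordinal lt)) //= mulrAC -exprD.
  have -> : (j + (m.-1 - j))%N = m.-1 by lia.
  by rewrite divff ?expf_neq0 // subrr mul0r.
under eq_bigr => k _ do rewrite (horner_coef_wide _ szp) mulr_sumr.
rewrite exchange_big /= big1 // => j _.
under eq_bigr => k _ do rewrite mulrCA.
by rewrite -mulr_sumr mono // mulr0.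
Qed.

Variables (a b : F).
Let u k := a + b * q ^+ k.

(** In the usual notation (1 - a - b) (a q^(1-k) + b q)_(k-1). At k = 0 the subscript is -1 and the
    value is 1, hence the separate case. *)
Definition rothe_coef (k : nat) : F :=
  if k is k'.+1 then (1 - u 0) * \prod_(s < k') (1 - u k / q ^+ s.+1) else 1.

(** The factor (-1)^k q^(k choose 2) by which [qbs] differs from the Gaussian binomial. *)
Let sq k := \prod_(t < k) - (q ^+ t).

Let sq_neq0 k : sq k != 0.
Proof. by apply/prodf_neq0 => t _; rewrite oppr_eq0 expf_neq0. Qed.

Let sqr_sq k : sq k ^+ 2 = q ^+ (k * k.-1).
Proof.
elim: k => [|k IH]; first by rewrite /sq big_ord0 expr1n.
rewrite /sq big_ord_recr /= exprMn IH sqrrN -exprM -exprD; congr (_ ^+ _).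
by case: k {IH} => //= k; lia.
Qed.

(** The signed form of [n, k] [n-k, m-k] = [n, m] [m, k]; the divisor accounts for (m choose 2) = (k
    choose 2) + (m-k choose 2) + k (m-k). *)
Lemma qbs_trinomial n m k : (k <= m <= n)%N ->
  qbs q n k * qbs q (n - k) (m - k) =
  qbs q n m * (qbs q m k / (sq k * q ^+ (k * (m - k)))).
Proof.
move=> /andP[lekm lemn]; rewrite /qbs !prodf_div.
have split i j (G : nat -> F) : \prod_(t < i + j) G t =
    \prod_(t < i) G t * \prod_(t < j) G (i + t)%N by rewrite big_split_ord.
set D := fun k => \prod_(t < k) (1 - q ^+ t.+1).
have D0 i : D i != 0 by apply/prodf_neq0 => t _; exact: q_aper.
have hD : D m = D (m - k)%N * ((\prod_(t < k) (q ^+ m - q ^+ t)) / sq k).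
  rewrite /D /sq -prodf_div.
  have -> : \prod_(i < k) ((q ^+ m - q ^+ i) / - q ^+ i) =
      \prod_(i < k) (1 - q ^+ (m - k + i).+1).
    rewrite [RHS](reindex_inj rev_ord_inj) /=; apply: eq_bigr => i _.
    have -> : (m - k + (k - i.+1)).+1 = (m - i)%N by have := ltn_ord i; lia.
    have -> : q ^+ m = q ^+ (m - i) * q ^+ i.
      by rewrite -exprD subnK //; have := ltn_ord i; lia.
    by rewrite -{2}[q ^+ i]mul1r -mulrBl invrN mulrN mulfK ?expf_neq0 // opprB.
  by rewrite -(split _ _ (fun t => 1 - q ^+ t.+1)) subnK.
have hN : \prod_(t < m) (q ^+ n - q ^+ t) = \prod_(t < k) (q ^+ n - q ^+ t) *
   (q ^+ (k * (m - k)) * \prod_(t < m - k) (q ^+ (n - k) - q ^+ t)).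
  have := split k (m - k)%N (fun t => q ^+ n - q ^+ t).
  rewrite subnKC // => ->; congr (_ * _).
  have -> : q ^+ (k * (m - k)) = \prod_(t < m - k) q ^+ k.
    by rewrite prodr_const card_ord exprM.
  rewrite -big_split.
  apply: eq_bigr => i _ /=; rewrite mulrBr -!exprD subnKC //.
  exact: leq_trans lekm lemn.
rewrite -/(D k) -/(D m) -/(D (m - k)%N) hN.
have nz := expf_neq0 (k * (m - k))%N q_neq0.
have Dm := D0 m; rewrite hD in Dm *.
set P := \prod_(t < k) (q ^+ m - q ^+ t) in Dm *.
have P0 : P != 0.
  by apply: contraNneq Dm => ->; rewrite mul0r mulr0.
by field; rewrite P0 nz sq_neq0 !D0.
Qed.

(** For k > 0 the summands are, up to the factor -(1 - u 0), those of an m-th q-difference of a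
    polynomial of degree < m, which vanishes. At k = 0 the two disagree, and the discrepancy is the
    1 on the right. *)
Lemma rothe_coef_sum m :
  \sum_(k < m.+1) qbs q m k / (sq k * q ^+ (k * (m - k))) * rothe_coef k *
     u k ^+ (m - k) = 1.
Proof.
case: m => [|m].
  by rewrite big_ord1 /= qbs0 /sq big_ord0 !mulr1 divr1.
(* At t = q^(k+1), with u = a + bt, the wanted value is u^(m-k) times the product of the u - q^(s+1)
   for s < k. By [qbinomial] it is the sum of the u^(m-l) q^l [qbs q k l], and q^l [qbs q k l] is a
   polynomial of degree l in t. Since the terms with l > k vanish, l may run up to m, which frees
   the formula from k. *)
pose p : {poly F} := \sum_(l < m.+1) (a%:P + b *: 'X) ^+ (m - l) *
  \prod_(i < l) ((1 - q ^+ i.+1)^-1 *: ('X - (q ^+ i.+1)%:P)).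
have szp : (size p <= m.+1)%N.
  apply: (leq_trans (size_sum _ _ _)); apply/bigmax_leqP => -[l lm] _ /=.
  have sz1 : (size (a%:P + b *: 'X)%R <= 2)%N.
    apply: (leq_trans (size_polyD _ _)); rewrite geq_max.
    rewrite (leq_trans (size_polyC_leq1 _)) //=.
    by rewrite (leq_trans (size_scale_leq _ _)) // size_polyX.
  apply: (leq_trans (size_polyMleq _ _)).
  have s1 : (size ((a%:P + b *: 'X) ^+ (m - l))%R <= (m - l).+1)%N.
    apply: (leq_trans (size_poly_exp_leq _ _)).
    rewrite ltnS -{2}[(m - l)%N]mul1n leq_mul2r.
    by apply/orP; right; lia.
  have s2 : (size (\prod_(i < l) ((1 - q ^+ i.+1)^-1 *:
     ('X - (q ^+ i.+1)%:P)))%R <= l.+1)%N.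
    apply: (leq_trans (size_poly_prod_leq _ _)).
    have : (\sum_(i < l) size ((1 - q ^+ i.+1)^-1 *:
       ('X - (q ^+ i.+1)%:P))%R <= \sum_(i < l) 2)%N.
      apply: leq_sum => i _.
      by rewrite (leq_trans (size_scale_leq _ _)) // size_XsubC.
    rewrite sum_nat_const card_ord => hle.
    by rewrite leq_subLR addnS ltnS; apply: (leq_trans hle); lia.
  by rewrite -subn1 leq_subLR; apply: (leq_trans (leq_add s1 s2)); lia.
have pE t : p.[t] = \sum_(l < m.+1) (a + b * t) ^+ (m - l) *
   \prod_(i < l) ((t - q ^+ i.+1) / (1 - q ^+ i.+1)).
  rewrite horner_sum; apply: eq_bigr => l _.
  rewrite hornerM horner_exp !hornerE horner_prod; congr (_ * _).
  by apply: eq_bigr => i _; rewrite !hornerE mulrC.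
(* At t = 1 every quotient is 1 and the sum over l is geometric. *)
have p1 : (1 - u 0) * p.[1] = 1 - u 0 ^+ m.+1.
  rewrite pE -[RHS]opprB subrX1 -mulNr opprB; congr (_ * _).
  rewrite [RHS](reindex_inj rev_ord_inj) /=.
  apply: eq_bigr => l _; rewrite big1 ?mulr1.
    by rewrite subSS /u expr0 mulr1.
  by move=> i _; rewrite divff.
have pS k : (k <= m)%N ->
    p.[q ^+ k.+1] = u k.+1 ^+ (m - k) * \prod_(s < k) (u k.+1 - q ^+ s.+1).
  move=> lekm; rewrite pE.
  under [X in _ = _ * X]eq_bigr => s _ do rewrite exprS.
  rewrite qbinomial mulr_sumr.
  have -> : \sum_(i < k.+1) u k.+1 ^+ (m - k) * (qbs q k i * q ^+ i *
    u k.+1 ^+ (k - i)) = \sum_(0 <= l < k.+1) u k.+1 ^+ (m - l) * (q ^+ l * qbs q k l).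
    rewrite big_mkord; apply: eq_bigr => l _.
    have -> : (m - l)%N = (m - k + (k - l))%N by have := ltn_ord l; lia.
    rewrite exprD; ring.
  have -> : \sum_(l < m.+1) (a + b * q ^+ k.+1) ^+ (m - l) *
     \prod_(i < l) ((q ^+ k.+1 - q ^+ i.+1) / (1 - q ^+ i.+1)) =
     \sum_(0 <= l < m.+1) u k.+1 ^+ (m - l) * (q ^+ l * qbs q k l).
    rewrite big_mkord; apply: eq_bigr => l _; congr (_ * _).
    have -> : q ^+ l = \prod_(i < l) q by rewrite prodr_const card_ord.
    rewrite /qbs -big_split /=.
    by apply: eq_bigr => i _; rewrite mulrA mulrBr -!exprS.
  rewrite (big_cat_nat (n := k.+1)) //= [X in _ + X]big_nat [X in _ + X]big1 ?addr0 //.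
  by move=> i /andP[ki _]; rewrite qbs_small // !mulr0.
transitivity (1 - (1 - u 0) *
    \sum_(k < m.+2) qbs q m.+1 k * q ^- (k * m) * p.[q ^+ k]); last first.
  by rewrite (qdiff_poly szp) mulr0 subr0.
rewrite big_ord_recl [in RHS]big_ord_recl [X in 1 - X]mulrDr [X in _ = 1 + X]opprD.
rewrite addrA; congr (_ + _).
  rewrite qbs0 /sq big_ord0 !mul0n !expr0 !mulr1 subn0 divr1 !mul1r.
  by rewrite ?invr1 ?divr1 ?mul1r p1 opprB addrCA subrr addr0.
rewrite mulr_sumr -sumrN; apply: eq_bigr => k _.
rewrite /rothe_coef !lift0 subSS pS; last by have := ltn_ord k; lia.
have -> : \prod_(s < k) (1 - u k.+1 / q ^+ s.+1) =
   - (\prod_(s < k) (u k.+1 - q ^+ s.+1)) / sq k.+1.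
  rewrite /sq big_ord_recl expr0 mulN1r invrN mulrNN -prodf_div.
  apply: eq_bigr => s _; rewrite lift0.
  by rewrite invrN mulrN mulrBl divff ?expf_neq0 // opprB.
have hs : q ^+ (k.+1 * m) = sq k.+1 ^+ 2 * q ^+ (k.+1 * (m - k)).
  by rewrite sqr_sq -exprD /=; congr (_ ^+ _); have := ltn_ord k; nia.
rewrite hs.
have nz := expf_neq0 (k.+1 * (m - k))%N q_neq0.
by field; rewrite nz sq_neq0.
Qed.

(* Comparing coefficients of c^m reduces this to [rothe_coef_sum]. *)
Lemma abel_rothe n c :
  qpn q n c = \sum_(k < n.+1) qbs q n k * c ^+ k * rothe_coef k *
     qpn q (n - k) (c * u k).
Proof.
rewrite qpnE.
transitivity (\sum_(k < n.+1) \sum_(m < n.+1 | (k <= m)%N)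
   qbs q n k * rothe_coef k * qbs q (n - k) (m - k) * u k ^+ (m - k) * c ^+ m);
  last first.
  apply: eq_bigr => k _; rewrite qpnE mulr_sumr.
  have lekn : (k <= n)%N by have := ltn_ord k; lia.
  rewrite -(big_mkord predT (fun j => qbs q n k * c ^+ k * rothe_coef k *
     (qbs q (n - k) j * (c * u k) ^+ j))).
  rewrite -(big_mkord (fun m => (k <= m)%N) (fun m => qbs q n k * rothe_coef k *
     qbs q (n - k) (m - k) * u k ^+ (m - k) * c ^+ m)).
  have -> : \sum_(0 <= m < n.+1 | (k <= m)%N) qbs q n k * rothe_coef k *
     qbs q (n - k) (m - k) * u k ^+ (m - k) * c ^+ m =
     \sum_(k <= m < n.+1) qbs q n k * rothe_coef k *
     qbs q (n - k) (m - k) * u k ^+ (m - k) * c ^+ m.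
    rewrite (big_cat_nat (n := k)) //= ?leqW //.
    rewrite big_nat_cond big1 ?add0r; last first.
      by move=> i /andP[/andP[_ h1] h2]; lia.
    rewrite big_nat_cond [RHS]big_nat_cond; apply: eq_bigl => i.
    by case: (k <= i)%N; rewrite ?andbT ?andbF.
  have shift (G : nat -> F) :
      \sum_(k <= m < n.+1) G m = \sum_(0 <= j < n.+1 - k) G (j + k)%N.
    by rewrite -{1}[k : nat]add0n big_addn.
  rewrite shift subSn //; apply: eq_bigr => j _.
  by rewrite addnK exprMn exprD; ring.
rewrite (exchange_big_dep predT) //=; apply: eq_bigr => m _.
rewrite -[LHS]mulr1 -(rothe_coef_sum m) mulr_sumr.
rewrite -(big_mkord predT (fun k => qbs q n m * c ^+ m * (qbs q m k /
    (sq k * q ^+ (k * (m - k))) * rothe_coef k * u k ^+ (m - k)))).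
rewrite -(big_mkord (fun k => (k <= m)%N) (fun k => qbs q n k * rothe_coef k *
     qbs q (n - k) (m - k) * u k ^+ (m - k) * c ^+ m)).
have ltmn := ltn_ord m.
rewrite [RHS](big_cat_nat (n := m.+1)) //=.
rewrite [X in _ = _ + X]big_nat_cond [X in _ = _ + X]big1 ?addr0; last first.
  by move=> i /andP[/andP[h1 h2] h3]; lia.
rewrite big_nat_cond [RHS]big_nat_cond; apply: eq_big => k.
  by rewrite andbT /= ltnS; case: leqP.
rewrite andbT => /= lekm.
have := @qbs_trinomial n m k; rewrite -ltnS lekm -ltnS ltmn => /(_ isT) h.
transitivity (qbs q n m * (qbs q m k / (sq k * q ^+ (k * (m - k)))) *
   rothe_coef k * u k ^+ (m - k) * c ^+ m).
  by ring.
by rewrite -h; ring.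
Qed.

End AbelRothe.

(** * Lagrange interpolation and partial fractions *)

Section PartialFractions.

Variables (F : fieldType) (r : nat).

Lemma lagrange_at0 (s : 'I_r -> F) (p : {poly F}) :
  injective s -> (size p <= r)%N ->
  p.[0] = \sum_(i < r) p.[s i] * \prod_(j < r | j != i) (- s j / (s i - s j)).
Proof.
move=> s_inj szp.
pose l i : {poly F} := \prod_(j < r | j != i) ((s i - s j)^-1 *: ('X - (s j)%:P)).
pose L := \sum_(i < r) p.[s i] *: l i.
have lE i t : (l i).[t] = \prod_(j < r | j != i) ((t - s j) / (s i - s j)).
  rewrite /l horner_prod; apply: eq_bigr => j _.
  by rewrite !hornerE mulrC.
have szl i : (size (l i) <= r)%N.
  apply: (leq_trans (size_poly_prod_leq _ _)).
  have h : (\sum_(j < r | j != i) size ((s i - s j)^-1 *: ('X - (s j)%:P))%R <=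
      \sum_(j < r | j != i) 2)%N.
    apply: leq_sum => j _.
    by rewrite (leq_trans (size_scale_leq _ _)) // size_XsubC.
  rewrite sum_nat_const in h.
  have hc : #|(fun j : 'I_r => j != i)| = r.-1.
    by rewrite -[in RHS](card_ord r) -(cardC1 i); apply: eq_card.
  rewrite hc; rewrite hc in h.
  rewrite leq_subLR (leq_trans (_ : _ <= (r.-1 * 2).+1)%N) // ?ltnS //.
  by have := ltn_ord i; lia.
suff -> : p = L.
  rewrite {1}/L horner_sum; apply: eq_bigr => i _; rewrite hornerZ.
  congr (_ * _); last by rewrite lE; apply: eq_bigr => j _; rewrite sub0r.
  rewrite /L horner_sum (bigD1 i) //= big1 ?addr0.
    rewrite hornerZ lE big1 ?mulr1 // => j ji.
    by rewrite divff // subr_eq0 (inj_eq s_inj) eq_sym.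
  move=> j ji; rewrite hornerZ lE (bigD1 i) 1?eq_sym //=.
  by rewrite subrr !mul0r mulr0.
apply/eqP; rewrite -subr_eq0; apply/eqP.
apply: (@roots_geq_poly_eq0 _ _ [seq s i | i <- enum 'I_r]).
- apply/allP => _ /mapP[i _ ->]; rewrite /root !hornerE subr_eq0 /L horner_sum.
  rewrite (bigD1 i) //= big1 ?addr0; last first.
    move=> j ji; rewrite hornerZ lE (bigD1 i) 1?eq_sym //=.
    by rewrite subrr !mul0r mulr0.
  rewrite hornerZ lE big1 ?mulr1 // => j ji.
  by rewrite divff // subr_eq0 (inj_eq s_inj) eq_sym.
- by rewrite map_inj_uniq ?enum_uniq.
- rewrite size_map size_enum_ord.
  apply: (leq_trans (size_polyD _ _)); rewrite size_polyN geq_max szp /=.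
  apply: (leq_trans (size_sum _ _ _)); apply/bigmax_leqP => i _.
  exact: (leq_trans (size_scale_leq _ _)).
Qed.

(** Interpolation at 0 of the difference of the monic polynomials with roots c_j s_j and s_j: the
    leading terms cancel, and at a node s_i only the first product survives. *)
Lemma partial_fractions (s c : 'I_r -> F) :
  injective s -> (forall i, s i != 0) ->
  \sum_(i < r) (\prod_(j < r) (1 - c j * (s j / s i))) /
     (\prod_(j < r | j != i) (1 - s j / s i)) = 1 - \prod_(j < r) c j.
Proof.
move=> s_inj s0.
pose p : {poly F} := \prod_(j < r) ('X - (c j * s j)%:P) -
  \prod_(j < r) ('X - (s j)%:P).
have szP (d : 'I_r -> F) : size (\prod_(j < r) ('X - (d j)%:P)) = r.+1.
  by rewrite size_prod_XsubC -[in RHS](card_ord r) cardT enumT.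
have mon (d : 'I_r -> F) : (\prod_(j < r) ('X - (d j)%:P))`_r = 1.
  have := monic_prod_XsubC (index_enum 'I_r) predT d.
  by rewrite monicE lead_coefE szP => /eqP.
have szp : (size p <= r)%N.
  apply/leq_sizeP => j; rewrite leq_eqVlt => /orP[/eqP<-|rj].
    by rewrite coefB !mon subrr.
  by rewrite coefB !nth_default ?subrr ?szP.
have := lagrange_at0 s_inj szp.
have hp0 : p.[0] = (\prod_j - s j) * (\prod_j c j - 1).
  rewrite /p hornerD hornerN !horner_prod mulrBr mulr1 -big_split /=.
  congr (_ - _); apply: eq_bigr => j _; rewrite !hornerE; ring.
have hpi i : p.[s i] = \prod_(j < r) (s i - c j * s j).
  rewrite /p hornerD hornerN !horner_prod.
  rewrite [X in _ - X](bigD1 i) //= !hornerE subrr mul0r subr0.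
  by apply: eq_bigr => j _; rewrite !hornerE.
rewrite hp0 => h.
have S0 : \prod_j - s j != 0 by apply/prodf_neq0 => j _; rewrite oppr_eq0.
apply: (mulfI S0); rewrite -[1 - _]opprB mulrN h mulr_sumr -sumrN.
apply: eq_bigr => i _; rewrite hpi (bigD1 i) //=.
have -> : \prod_(j < r) (1 - c j * (s j / s i)) =
   (\prod_(j < r) (s i - c j * s j)) / (s i * \prod_(j < r | j != i) s i).
  rewrite -(bigD1 i (P := predT) (F := fun _ => s i)) //= -prodf_div.
  by apply: eq_bigr => j _; field.
have -> : \prod_(j < r | j != i) (1 - s j / s i) =
   \prod_(j < r | j != i) (s i - s j) / \prod_(j < r | j != i) s i.
  by rewrite -prodf_div; apply: eq_bigr => j _; field.
rewrite prodf_div.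
have n1 : \prod_(j < r | j != i) s i != 0 by apply/prodf_neq0.
have n2 : \prod_(j < r | j != i) (s i - s j) != 0.
  by apply/prodf_neq0 => j ji; rewrite subr_eq0 (inj_eq s_inj) eq_sym.
by field; rewrite n1 n2 s0.
Qed.

(** Serves to change one coordinate i of a Vandermonde product: only the pairs containing i
    matter. *)
Lemma prod_pairs_at (w : 'I_r -> 'I_r -> F) (i : 'I_r) :
  (forall j k, w j k = w k j) ->
  (forall j k, j != k -> j != i -> k != i -> w j k = 1) ->
  \prod_(j < r) \prod_(k < r | (j < k)%N) w j k = \prod_(j < r | j != i) w i j.
Proof.
move=> w_sym w1; rewrite (bigD1 i) //=.
have -> : \prod_(j < r | j != i) \prod_(k < r | (j < k)%N) w j k =
   \prod_(j < r | (j != i) && (j < i)%N) w i j.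
  rewrite [RHS]big_mkcondr /=; apply: eq_bigr => j ji.
  have [lt|ge] := ltnP j i.
    rewrite (bigD1 i) //= big1 ?mulr1 // => k /andP[jk ki].
    by apply: w1 => //; rewrite -val_eqE neq_ltn jk.
  apply: big1 => k jk; apply: w1 => //; rewrite -val_eqE neq_ltn ?jk //.
  by rewrite (leq_ltn_trans ge jk) orbT.
rewrite [RHS](bigID (fun j : 'I_r => (j < i)%N)) /= mulrC; congr (_ * _).
apply: eq_bigl => j; rewrite -val_eqE /=; by case: ltngtP.
Qed.

End PartialFractions.

(** * Milne's summation over a box *)

Section Milne.

Variables (F : fieldType) (q : F).
Hypotheses (q_neq0 : q != 0) (q_aper : forall n, 1 - q ^+ n.+1 != 0).
Variables (r m : nat) (x : 'I_r -> F).
Hypothesis x_neq0 : forall i, x i != 0.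
Hypothesis x_gen : forall i j (s t : nat), i != j -> x i * q ^+ s != x j * q ^+ t.

Definition vdm_ratio (k : 'I_r -> nat) : F :=
  \prod_(i < r) \prod_(j < r | (i < j)%N)
    ((x i * q ^+ k i - x j * q ^+ k j) / (x i - x j)).

(** For r = 1 this is [qbs q m s] divided by (q)_m. The lengths m - s and s are complementary, so
    that products of length m can later absorb the denominators. *)
Definition milne_factor (i : 'I_r) (s : nat) : F :=
  \prod_(j < r) ((- (x i / x j)) ^+ s * q ^+ 'C(s, 2) /
    (qpn q (m - s) (x j / x i * q) * qpn q s (x i / x j * q))).

Definition milne_term (k : 'I_r -> nat) : F :=
  vdm_ratio k * \prod_(i < r) milne_factor i (k i).

Lemma x_gen1 i j s : 1 - x i / x j * q ^+ s.+1 != 0.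
Proof.
have [->|ij] := eqVneq i j; first by rewrite divff // mul1r.
rewrite subr_eq0; apply/eqP => h.
have := @x_gen i j s.+1 0 ij; rewrite expr0 mulr1 => /eqP; apply.
by rewrite -[RHS]mulr1 h [RHS]mulrA [x j * (_ / _)]mulrC divfK.
Qed.

Lemma qpn_gen_neq0 i j s : qpn q s (x i / x j * q) != 0.
Proof.
rewrite /qpn; apply/prodf_neq0 => t _.
by have := x_gen1 i j t; rewrite exprS mulrA.
Qed.

Lemma milne_factorS i s : (s < m)%N ->
  milne_factor i s.+1 = milne_factor i s *
  \prod_(j < r) (- (x i * q ^+ s / x j) *
     (1 - x j * q ^+ m / (x i * q ^+ s)) / (1 - q * (x i * q ^+ s) / x j)).
Proof.
move=> ltsm; rewrite /milne_factor -big_split; apply: eq_bigr => j _ /=.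
have -> : (m - s = (m - s.+1).+1)%N by lia.
have hm : q ^+ m = q * q ^+ (m - s.+1) * q ^+ s.
  by rewrite -exprS -exprD; congr (_ ^+ _); lia.
rewrite binS bin1 exprD exprSr [qpn q (m - s.+1).+1 _]/qpn big_ord_recr /=.
rewrite [qpn q s.+1 _]/qpn big_ord_recr /= -!/(qpn _ _ _) hm.
have n1 := qpn_gen_neq0 i j s; have n2 := qpn_gen_neq0 j i (m - s.+1).
have n3 := x_gen1 i j s; have n4 := x_gen1 j i (m - s.+1).
have n5 := expf_neq0 s q_neq0.
rewrite exprS in n3; rewrite exprS in n4.
have n3' : x j - q * (x i * q ^+ s) != 0.
  have := mulf_neq0 (x_neq0 j) n3; congr (_ != 0).
  by field.
have n4' : x i - x j * q * q ^+ (m - s.+1) != 0.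
  have := mulf_neq0 (x_neq0 i) n4; congr (_ != 0).
  by field.
by field; rewrite !x_neq0 n1 n2 n3' n4' n5.
Qed.

Section Step.

Variables (k : 'I_r -> nat) (i : 'I_r).
Hypothesis k_lt : (k i < m)%N.
Let k' j := (k j + (j == i))%N.
Let y j := x j * q ^+ k j.

Let y_neq0 j : y j != 0.
Proof. by rewrite mulf_neq0 ?expf_neq0. Qed.

Let yk' j : x j * q ^+ k' j = if j == i then q * y i else y j.
Proof.
rewrite /k'; case: eqVneq => [->|_]; last by rewrite addn0.
by rewrite addn1 exprS mulrCA.
Qed.

Lemma vdm_ratio_step :
  vdm_ratio k' = vdm_ratio k *
    \prod_(j < r | j != i) ((q * y i - y j) / (y i - y j)).
Proof.
pose w j l := if j == l then 1 else
   (x j * q ^+ k' j - x l * q ^+ k' l) / (y j - y l).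
have -> : \prod_(j < r | j != i) ((q * y i - y j) / (y i - y j)) =
    \prod_(j < r | j != i) w i j.
  apply: eq_bigr => j ji; rewrite /w !yk' eqxx (negbTE ji).
  by rewrite eq_sym (negbTE ji).
rewrite -prod_pairs_at.
- rewrite /vdm_ratio -big_split; apply: eq_bigr => j _ /=.
  rewrite -big_split; apply: eq_bigr => l jl /=.
  have njl : j != l by rewrite -val_eqE neq_ltn jl.
  have n1 : y j - y l != 0 by rewrite subr_eq0 x_gen.
  have n2 : x j - x l != 0.
    by rewrite subr_eq0; have := @x_gen j l 0 0 njl; rewrite !mulr1.
  rewrite /w (negbTE njl) -/(y j) -/(y l).
  by field; rewrite n1 n2.
- move=> j l; rewrite /w eq_sym; case: eqVneq => // _.
  by rewrite -[LHS]mulrNN -invrN !opprB.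
- move=> j l jl ji li; rewrite /w (negbTE jl) !yk' (negbTE ji) (negbTE li).
  by rewrite divff // subr_eq0 x_gen.
Qed.

(** The two quotients are the i-th summands of the partial fraction expansions at [k'] and at [k];
    the recurrence holds already at this level, one i at a time. *)
Lemma milne_term_step :
  milne_term k' * ((\prod_(j < r) (1 - q * y i / x j)) /
     \prod_(j < r | j != i) (1 - q * y i / y j)) =
  - (\prod_(j < r) q ^+ k j) * (milne_term k *
   ((\prod_(j < r) (1 - x j * q ^+ m / y i)) /
     \prod_(j < r | j != i) (1 - y j / y i))).
Proof.
rewrite /milne_term vdm_ratio_step.
have -> : \prod_j milne_factor j (k' j) = \prod_j milne_factor j (k j) *
  \prod_(j < r) (- (y i / x j) * (1 - x j * q ^+ m / y i) /
    (1 - q * y i / x j)).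
  rewrite (bigD1 i) //= [in RHS](bigD1 i) //= {1}/k' eqxx addn1 milne_factorS //.
  rewrite mulrAC; congr (_ * _ * _); apply: eq_bigr => j ji.
  by rewrite /k' (negbTE ji) addn0.
have nz j : 1 - q * y i / x j != 0.
  have := x_gen1 i j (k i); rewrite exprS; congr (1 - _ != 0).
  by rewrite /y; ring.
set V := vdm_ratio k; set P := \prod_j milne_factor j (k j).
transitivity (V * P * ((\prod_(j < r | j != i) ((q * y i - y j) / (y i - y j)))
   / \prod_(j < r | j != i) (1 - q * y i / y j)) *
  ((\prod_(j < r) (- (y i / x j) * (1 - x j * q ^+ m / y i) /
    (1 - q * y i / x j))) * \prod_(j < r) (1 - q * y i / x j))); first by ring.
rewrite -prodf_div -[X in _ * X = _]big_split /=.
have -> : \prod_(j < r | j != i) ((q * y i - y j) / (y i - y j) /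
     (1 - q * y i / y j)) =
   (\prod_(j < r | j != i) - (y j / y i)) / \prod_(j < r | j != i) (1 - y j / y i).
  rewrite -prodf_div; apply: eq_bigr => j ji.
  have ij : i != j by rewrite eq_sym.
  have n1 : y i - y j != 0 by rewrite subr_eq0 x_gen.
  have n2 : y j - q * y i != 0.
    rewrite subr_eq0 /y mulrCA -exprS; exact: x_gen.
  by field; rewrite !y_neq0 n1 n2.
have -> : \prod_(j < r) (- (y i / x j) * (1 - x j * q ^+ m / y i) /
    (1 - q * y i / x j) * (1 - q * y i / x j)) =
  (\prod_(j < r) - (y i / x j)) * \prod_(j < r) (1 - x j * q ^+ m / y i).
  by rewrite -big_split; apply: eq_bigr => j _ /=; rewrite divfK.
have h : (\prod_(j < r | j != i) - (y j / y i)) * (\prod_(j < r) - (y i / x j)) =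
   - \prod_(j < r) q ^+ k j.
  rewrite [X in _ * X](bigD1 i) //= mulrCA -big_split /= mulNr; congr (- _).
  rewrite [RHS](bigD1 i) //=; congr (_ * _); first by rewrite /y; field.
  by apply: eq_bigr => j _; rewrite mulrNN mulrA divfK // /y mulrAC divff // mul1r.
rewrite -h; ring.
Qed.

End Step.

Local Notation nk k := (fun i : 'I_r => (k : {ffun 'I_r -> 'I_m.+1}) i : nat).

(** On the level |k| = M+1 the factor 1 - q^|k| is the sum of the [A k i], and on the level |k| = M
    the factor q^(rm) - q^|k| is -q^|k| times the sum of the [B k i]. The i-th parts correspond
    under raising k_i by one. *)
Lemma milne_rec M :
  (1 - q ^+ M.+1) *
    \sum_(k : {ffun 'I_r -> 'I_m.+1} | (\sum_i k i)%N == M.+1) milne_term (nk k) =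
  (q ^+ (r * m) - q ^+ M) *
    \sum_(k : {ffun 'I_r -> 'I_m.+1} | (\sum_i k i)%N == M) milne_term (nk k).
Proof.
pose y (k : 'I_r -> nat) j := x j * q ^+ k j.
have y0 k j : y k j != 0 by rewrite mulf_neq0 ?expf_neq0.
have y_inj k : injective (y k).
  by move=> i j; apply: contra_eq => ij; exact: x_gen.
pose A (k : 'I_r -> nat) i := (\prod_(j < r) (1 - y k i / x j)) /
     \prod_(j < r | j != i) (1 - y k i / y k j).
pose B (k : 'I_r -> nat) i := (\prod_(j < r) (1 - x j * q ^+ m / y k i)) /
     \prod_(j < r | j != i) (1 - y k j / y k i).
have sumA (k : 'I_r -> nat) : \sum_i A k i = 1 - q ^+ (\sum_i k i).
  have inj' : injective (fun i => (y k i)^-1).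
    by move=> i j /invr_inj /y_inj.
  have n0 i : (y k i)^-1 != 0 by rewrite invr_eq0.
  have := partial_fractions (fun i => q ^+ k i) inj' n0.
  rewrite -expr_sum => <-; apply: eq_bigr => i _; congr (_ / _).
    apply: eq_bigr => j _; congr (1 - _); rewrite invrK /y invfM.
    by field; rewrite x_neq0 expf_neq0.
  by apply: eq_bigr => j _; rewrite invrK mulrC.
have sumB (k : {ffun 'I_r -> 'I_m.+1}) :
    q ^+ (\sum_i k i) * \sum_i B (nk k) i = q ^+ (\sum_i k i) - q ^+ (r * m).
  have := partial_fractions (fun i => q ^+ (m - k i)) (@y_inj (nk k)) (y0 (nk k)).
  rewrite -expr_sum => h.
  have -> : \sum_i B (nk k) i = 1 - q ^+ (\sum_i (m - k i)).
    rewrite -h; apply: eq_bigr => i _; congr (_ / _).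
    apply: eq_bigr => j _; congr (1 - _); rewrite {2}/y.
    have -> : q ^+ m = q ^+ (m - k j) * q ^+ k j.
      by rewrite -exprD subnK // -ltnS ltn_ord.
    by ring.
  rewrite mulrBr mulr1 -exprD -big_split /=.
  congr (_ - q ^+ _); rewrite -[r in RHS]card_ord -sum_nat_const.
  by apply: eq_bigr => i _; rewrite subnKC // -ltnS ltn_ord.
rewrite mulr_sumr mulr_sumr.
transitivity (\sum_(i < r) \sum_(k : {ffun 'I_r -> 'I_m.+1} |
     (\sum_i k i)%N == M.+1) milne_term (nk k) * A (nk k) i).
  rewrite exchange_big /=; apply: eq_bigr => k /eqP kM.
  by rewrite -mulr_sumr sumA kM mulrC.
transitivity (\sum_(i < r) \sum_(k : {ffun 'I_r -> 'I_m.+1} |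
     (\sum_i k i)%N == M) - q ^+ M * (milne_term (nk k) * B (nk k) i)); last first.
  rewrite exchange_big /=; apply: eq_bigr => k /eqP kM.
  rewrite -mulr_sumr -mulr_sumr mulNr mulrCA -{1}kM sumB kM; ring.
apply: eq_bigr => i _.
(* [A] vanishes at k_i = 0, where y_i = x_i, and [B] at k_i = m, where y_i = x_i q^m. Nothing
   crosses the boundary of the box, and raising k_i is a bijection between the remaining indices. *)
rewrite (bigID (fun k : {ffun 'I_r -> 'I_m.+1} => (k i : nat) == 0%N)) /=.
rewrite big1 ?add0r; last first.
  move=> k /andP[_ /eqP ki0]; rewrite /A (bigD1 i) //= /y ki0 expr0 mulr1.
  by rewrite divff // subrr !mul0r mulr0.
rewrite [RHS](bigID (fun k : {ffun 'I_r -> 'I_m.+1} => (k i : nat) == m)) /=.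
rewrite [X in _ = X + _]big1 ?add0r; last first.
  move=> k /andP[_ /eqP kim]; rewrite /B (bigD1 i) //= /y kim.
  by rewrite divff ?mulf_neq0 ?expf_neq0 // subrr !mul0r !mulr0.
pose up (k : {ffun 'I_r -> 'I_m.+1}) : {ffun 'I_r -> 'I_m.+1} :=
  [ffun j => if j == i then inord (k j).+1 else k j].
pose dn (k : {ffun 'I_r -> 'I_m.+1}) : {ffun 'I_r -> 'I_m.+1} :=
  [ffun j => if j == i then inord (k j).-1 else k j].
have upE (k : {ffun 'I_r -> 'I_m.+1}) : (k i != m :> nat) ->
    forall j, up k j = (k j + (j == i))%N :> nat.
  move=> kim j; rewrite ffunE; case: eqVneq => [->|_]; last by rewrite addn0.
  by rewrite addn1 inordK // ltnS ltn_neqAle kim -ltnS ltn_ord.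
have up_sum (k : {ffun 'I_r -> 'I_m.+1}) : (k i != m :> nat) ->
    (\sum_j up k j)%N = (\sum_j k j).+1.
  move=> kim; rewrite (eq_bigr _ (fun j _ => upE k kim j)) big_split /=.
  by rewrite -big_mkcond big_pred1_eq addn1.
have dnK (k : {ffun 'I_r -> 'I_m.+1}) : (k i != 0 :> nat)%N -> up (dn k) = k.
  move=> ki0; apply/ffunP => j; apply/val_inj.
  rewrite !ffunE; case: eqVneq => [->|_] //=.
  rewrite inordK inordK ?prednK ?lt0n //; last by have := ltn_ord (k i); lia.
  by have := ltn_ord (k i); lia.
rewrite (reindex_onto up dn) /=; last by move=> k /andP[_ /dnK].
apply: eq_big => k.
  have [kim|kim] := eqVneq (k i : nat) m; last first.
    rewrite up_sum // eqSS upE // eqxx addn1 /=; case: eqP => //= _.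
    apply/eqP/ffunP => j; apply/val_inj; rewrite !ffunE.
    case: eqVneq => [->|] //=.
    by rewrite !inordK //= ?ltn_ord //; have := ltn_ord (k i); lia.
  (* At k_i = m the successor overflows and [inord] returns 0, which the condition on the i-th entry
     excludes. *)
  rewrite andbF; apply/negbTE/negP => /andP[/andP[_ h] _]; move: h.
  by rewrite ffunE eqxx kim /inord /insubd insubF //= ltnn.
move=> /andP[/andP[hM h0] /eqP hdn].
have kim : (k i != m :> nat).
  apply: contraNneq h0 => kim.
  by rewrite ffunE eqxx kim /inord /insubd insubF //= ltnn.
have lt : (k i < m)%N by rewrite ltn_neqAle kim -ltnS ltn_ord.
have := @milne_term_step (nk k) i lt.
have -> : (\prod_(j < r) q ^+ k j) = q ^+ M.
  by rewrite -expr_sum; move: hM; rewrite up_sum // eqSS => /eqP ->.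
rewrite mulNr => <-.
have e : (fun j => (k j + (j == i))%N) = (fun j => up k j : nat).
  by apply/funext => j; rewrite upE.
have yup j : y (nk (up k)) j = if j == i then q * y (nk k) i else y (nk k) j.
  rewrite /y upE //; case: eqVneq => [->|_]; last by rewrite addn0.
  by rewrite addn1 exprS mulrCA.
rewrite e; congr (_ * (_ / _)).
  by apply: eq_bigr => j _; rewrite yup eqxx.
by apply: eq_bigr => j ji; rewrite !yup eqxx (negbTE ji).
Qed.

Lemma milne_sum M :
  \sum_(k : {ffun 'I_r -> 'I_m.+1} | (\sum_i k i)%N == M) milne_term (nk k) =
  qbs q (r * m) M * (\prod_(i < r) \prod_(j < r) qpn q m (x i / x j * q))^-1.
Proof.
elim: M => [|M IH].
  rewrite qbs0 mul1r (big_pred1 [ffun=> ord0]); last first.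
    move=> k; rewrite /= sum_nat_eq0; apply/forallP/eqP => [h|-> i].
      by apply/ffunP => i; apply/val_inj; rewrite ffunE; apply/eqP; exact: h.
    by rewrite ffunE.
  rewrite /milne_term /vdm_ratio big1 ?mul1r.
    rewrite exchange_big /= -prodfV; apply: eq_bigr => i _.
    rewrite -prodfV; apply: eq_bigr => j _.
    by rewrite !ffunE /= bin0n !expr0 subn0 /qpn big_ord0 !mul1r mulr1.
  move=> i _; rewrite big1 // => j ij; rewrite !ffunE !mulr1 divff //.
  have nij : i != j by rewrite -val_eqE neq_ltn ij.
  by rewrite subr_eq0; have := @x_gen i j 0 0 nij; rewrite !mulr1.
have := milne_rec M; rewrite IH => h; apply: (mulfI (q_aper M)); rewrite h.
rewrite [in RHS]/qbs big_ord_recr /= -/(qbs q _ _).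
have D0 := q_aper M; set D := 1 - q ^+ M.+1 in D0 *.
have P0 : \prod_(i < r) \prod_(j < r) qpn q m (x i / x j * q) != 0.
  by apply/prodf_neq0 => i _; apply/prodf_neq0 => j _; exact: qpn_gen_neq0.
by field; rewrite D0 P0.
Qed.

Lemma milne_abel_rothe (a b c : F) :
  \sum_(k : {ffun 'I_r -> 'I_m.+1}) milne_term (nk k) * (c ^+ (\sum_i k i) *
     rothe_coef q a b (\sum_i k i) *
     qpn q (r * m - \sum_i k i) (c * (a + b * q ^+ (\sum_i k i)))) =
  qpn q (r * m) c * (\prod_(i < r) \prod_(j < r) qpn q m (x i / x j * q))^-1.
Proof.
rewrite (abel_rothe q_neq0 q_aper a b) mulr_suml.
have hle (k : {ffun 'I_r -> 'I_m.+1}) : (\sum_i k i < (r * m).+1)%N.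
  rewrite ltnS -[r in (r * m)%N]card_ord -sum_nat_const; apply: leq_sum => i _.
  by rewrite -ltnS ltn_ord.
rewrite (partition_big (fun k : {ffun 'I_r -> 'I_m.+1} => Ordinal (hle k)) predT) //=.
apply: eq_bigr => M _.
transitivity ((\sum_(k : {ffun 'I_r -> 'I_m.+1} | (\sum_i k i)%N == M)
     milne_term (nk k)) * (c ^+ M * rothe_coef q a b M *
     qpn q (r * m - M) (c * (a + b * q ^+ M)))).
  rewrite mulr_suml; apply: eq_big => k; first by rewrite -val_eqE.
  by move=> /eqP <-.
by rewrite milne_sum; ring.
Qed.

End Milne.

(** * Arithmetic of the exponents *)

Lemma binz2_double (k : int) : 2 * binz2 k = k * (k - 1).
Proof.
rewrite /binz2 mulrC divzK //.
have h : (k %% 2)%Z = 0 \/ (k %% 2)%Z = 1.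
  have h1 := modz_ge0 k (isT : (2 : int) != 0).
  have h2 := ltz_pmod k (isT : 0 < (2 : int)).
  by lia.
rewrite [X in (_ %| X * (X - _))%Z](divz_eq k 2); case: h => ->.
- by rewrite addr0 [_ * 2]mulrC -mulrA dvdz_mulr.
- by rewrite addrK [_ * (_ * 2)]mulrC [_ * 2]mulrC -mulrA dvdz_mulr.
Qed.

Lemma binz2_nat (n : nat) : binz2 n%:Z = 'C(n, 2)%:Z.
Proof.
have h : (2 * 'C(n, 2) = n * n.-1)%N.
  elim: n => // n IH; rewrite binS bin1 mulnDr IH /=.
  by case: n {IH} => // n; rewrite /=; lia.
by have := binz2_double n%:Z; case: n h => [|n] /= h; lia.
Qed.

Lemma binz2N (n : nat) : binz2 (- n%:Z) = 'C(n.+1, 2)%:Z.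
Proof.
rewrite -binz2_nat; apply: (@mulfI _ (2 : int)) => //.
by rewrite !binz2_double intS; ring.
Qed.

Lemma prod_exprz (F : fieldType) (I : finType) (P : pred I) (q : F)
    (f : I -> int) : q != 0 ->
  \prod_(i | P i) q ^ f i = q ^ (\sum_(i | P i) f i).
Proof.
move=> q0; apply/esym.
by apply: (big_morph (fun e => q ^ e)) => // e e'; rewrite expfzDr.
Qed.

(** Counts the factors of the Vandermonde ratio, each of which releases a q^n when the box is
    recentred. *)
Lemma num_pairs r : (2 * (\sum_(i < r) \sum_(j < r | (i < j)%N) 1) = r * r.-1)%N.
Proof.
have h (i : 'I_r) : (\sum_(j < r | (i < j)%N) 1 = r - i.+1)%N.
  rewrite -(big_mkord (fun j => (i < j)%N) (fun=> 1%N)).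
  rewrite (big_cat_nat (n := i.+1)) //=.
  rewrite big_nat_cond big1 ?add0n; last by move=> j /andP[/andP[_ h1] h2]; lia.
  rewrite big_nat_cond (eq_bigl (fun j => (i.+1 <= j < r)%N)); last first.
    by move=> j; case: (i < j)%N; rewrite ?andbT ?andbF.
  by rewrite -big_nat sum_nat_const_nat muln1.
rewrite (eq_bigr _ (fun i _ => h i)).
rewrite (reindex_inj rev_ord_inj) /=.
rewrite (eq_bigr (fun i : 'I_r => i : nat)); last first.
  by move=> i _; have := ltn_ord i; lia.
elim: r {h} => [|r IH]; first by rewrite big_ord0.
by rewrite big_ord_recr /= mulnDr IH; case: r {IH} => //= r; lia.
Qed.

(** * The finite bilateral identity *)

Section Bilateral.

Variables (F : fieldType) (q : F).
Hypotheses (q_neq0 : q != 0) (q_aper : forall n, 1 - q ^+ n.+1 != 0).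

Lemma qpnD m n x : qpn q (m + n) x = qpn q m x * qpn q n (x * q ^+ m).
Proof.
rewrite /qpn big_split_ord /=; congr (_ * _).
by apply: eq_bigr => j _; rewrite exprD mulrA.
Qed.

(** The first L of the 2L factors, read backwards, are those of (q/z)_L up to the factors -z
    q^(-j-1). This is how a single product becomes the two-sided (z, q/z). *)
Lemma qpn_reflect L z : z != 0 ->
  qpn q (L + L) (z * q ^- L) =
  (- z) ^+ L * q ^ (- 'C(L.+1, 2)%:Z) * (qpn q L z * qpn q L (q / z)).
Proof.
move=> z0; rewrite qpnD mulfVK ?expf_neq0 // mulrC.
suff -> : qpn q L (z * q ^- L) = (- z) ^+ L * q ^ (- 'C(L.+1, 2)%:Z) *
   qpn q L (q / z) by rewrite mulrCA mulrA; ring.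
rewrite /qpn (reindex_inj rev_ord_inj) /=.
have -> : q ^ (- 'C(L.+1, 2)%:Z) = \prod_(j < L) q ^ (- j.+1%:Z).
  rewrite prod_exprz //; congr (_ ^ _); rewrite sumrN; congr (- _).
  elim: L => [|L IH]; first by rewrite big_ord0.
  by rewrite big_ord_recr /= -IH binS bin1 -PoszD.
have -> : (- z) ^+ L = \prod_(j < L) - z by rewrite prodr_const card_ord.
rewrite -!big_split; apply: eq_bigr => j _ /=.
have hL : q ^+ L = q ^+ (L - j.+1) * (q * q ^+ j).
  by rewrite -exprS -exprD subnK.
rewrite -exprnN exprS hL.
have n1 := expf_neq0 j q_neq0; have n2 := expf_neq0 (L - j.+1)%N q_neq0.
by field; rewrite z0 n1 n2 q_neq0.
Qed.

Lemma rothe_coef_shift (a b : F) (L K : nat) (N : int) :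
  K.+1%:Z = L%:Z + N ->
  rothe_coef q (a * q ^+ L) b K.+1 =
  (1 - a * q ^+ L - b) * qpn q K (a * q ^ (1 - N) + b * q).
Proof.
move=> KN; rewrite /rothe_coef expr0 mulr1 opprD addrA; congr (_ * _).
rewrite /qpn (reindex_inj rev_ord_inj) /=; apply: eq_bigr => s _.
congr (1 - _).
have -> : (K - s.+1).+1 = (K - s)%N by have := ltn_ord s; lia.
have e1 : q ^+ K.+1 = q ^+ (K - s) * (q * q ^+ s).
  by rewrite -exprS -exprD; congr (_ ^+ _); have := ltn_ord s; lia.
have e2 : q ^+ L = q ^ (1 - N) * q ^+ s * q ^+ (K - s).
  rewrite !exprnP -!expfzDr //; congr (_ ^ _); have := ltn_ord s; lia.
rewrite e1 e2; have n := expf_neq0 (K - s)%N q_neq0.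
by field; rewrite n.
Qed.

Variables (r n : nat) (x : 'I_r -> F).
Hypothesis x_neq0 : forall i, x i != 0.

(** The part of the summand free of [a], [b], [z] and the sign. All the rest depends on k through
    |k| only. *)
Definition theta_weight (k : 'I_r -> int) : F :=
  (\prod_(i < r) \prod_(j < r | (i < j)%N)
     ((x i * q ^ k i - x j * q ^ k j) / (x i - x j)))
  * q ^ (r%:Z * \sum_(i < r) binz2 (k i))
  * \prod_(i < r) x i ^ (r%:Z * k i - \sum_(i < r) k i).

Definition box_shift (k : {ffun 'I_r -> 'I_(n + n).+1}) (i : 'I_r) : int :=
  (k i)%:Z - n%:Z.

(** What remains of the Milne denominators after multiplication by two full products of length 2n:
    tails of those products, which tend to 1 when n grows with the recentred index fixed. *)
Definition box_factor (k : {ffun 'I_r -> 'I_(n + n).+1}) : F :=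
  \prod_(i < r) \prod_(j < r)
   (qpn q (k i) (x j / x i * q * q ^+ (n + n - k i)) *
    qpn q (n + n - k i) (x i / x j * q * q ^+ k i)).

Lemma sum_box_shift (k : {ffun 'I_r -> 'I_(n + n).+1}) :
  \sum_(i < r) box_shift k i = (\sum_(i < r) k i)%N%:Z - (r * n)%N%:Z.
Proof.
rewrite /box_shift big_split /= sumrN sumr_const card_ord -natz -mulrnA natz.
by rewrite mulnC (big_morph Posz PoszD (erefl _)).
Qed.

Lemma vdm_ratio_shift (k : {ffun 'I_r -> 'I_(n + n).+1}) :
  vdm_ratio q x (fun i => k i) =
  q ^+ (n * \sum_(i < r) \sum_(j < r | (i < j)%N) 1) *
  \prod_(i < r) \prod_(j < r | (i < j)%N)
     ((x i * q ^ box_shift k i - x j * q ^ box_shift k j) / (x i - x j)).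
Proof.
rewrite exprM expr_sum -big_split; apply: eq_bigr => i _ /=.
rewrite expr_sum -big_split; apply: eq_bigr => j _ /=.
have e l : q ^+ k l = q ^+ n * q ^ box_shift k l.
  by rewrite !exprnP -expfzDr // /box_shift; congr (_ ^ _); lia.
by rewrite expr1 !e; ring.
Qed.

(** The exponents r k_i - |k| are invariant under recentring, so the powers of x_i need no
    correction; those of q are corrected in [bilateral_exponent]. *)
Lemma sum_box_monomial (k : {ffun 'I_r -> 'I_(n + n).+1}) :
  \prod_(i < r) \prod_(j < r) ((- (x i / x j)) ^+ k i * q ^+ 'C(k i, 2)) =
  (-1) ^+ (r * \sum_(i < r) k i) * q ^ (r%:Z * \sum_(i < r) binz2 (k i)) *
  \prod_(i < r) x i ^ (r%:Z * box_shift k i - \sum_(i < r) box_shift k i).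
Proof.
transitivity (\prod_(i < r) \prod_(j < r) ((-1) ^+ k i * q ^ binz2 (k i) *
   (x i ^ (k i)%:Z * x j ^ (- (k i)%:Z)))).
  apply: eq_bigr => i _; apply: eq_bigr => j _.
  rewrite -[- (x i / x j)]mulN1r exprMn binz2_nat expr_div_n -!exprnP -exprnN.
  by ring.
have -> : (-1) ^+ (r * \sum_(i < r) k i) =
    \prod_(i < r) \prod_(j < r) (-1) ^+ k i :> F.
  rewrite mulnC exprM expr_sum -prodrXl; apply: eq_bigr => i _.
  by rewrite prodr_const card_ord.
have -> : q ^ (r%:Z * \sum_(i < r) binz2 (k i)) =
    \prod_(i < r) \prod_(j < r) q ^ binz2 (k i).
  rewrite mulr_sumr -prod_exprz //; apply: eq_bigr => i _.
  by rewrite prodr_const card_ord mulrC -exprz_exp.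
have -> : \prod_(i < r) x i ^ (r%:Z * box_shift k i - \sum_(i < r) box_shift k i) =
   \prod_(i < r) \prod_(j < r) (x i ^ (k i)%:Z * x j ^ (- (k i)%:Z)).
  transitivity ((\prod_(i < r) \prod_(j < r) x i ^ (k i)%:Z) *
     \prod_(i < r) \prod_(j < r) x j ^ (- (k i)%:Z)); last first.
    rewrite -big_split; apply: eq_bigr => i _ /=.
    by rewrite -big_split.
  rewrite [X in _ = _ * X]exchange_big -big_split; apply: eq_bigr => i _ /=.
  rewrite !prod_exprz // -expfzDr //; congr (_ ^ _).
  rewrite sum_box_shift sumrN sumr_const card_ord /box_shift.
  rewrite -(big_morph Posz PoszD (erefl _)) -mulr_natl natz PoszM; ring.
rewrite -!big_split; apply: eq_bigr => i _ /=.
by rewrite -!big_split.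
Qed.

Hypothesis x_gen : forall i j (s t : nat), i != j -> x i * q ^+ s != x j * q ^+ t.

(** The left side collects the powers of q from recentring the Vandermonde ratio, from the Milne
    factors and from (z q^(-L))^|k| with L = rn. The constant on the right is the exponent in
    [qpn_reflect] and cancels against it. *)
Lemma bilateral_exponent (k : {ffun 'I_r -> 'I_(n + n).+1}) :
  (n * \sum_(i < r) \sum_(j < r | (i < j)%N) 1)%N%:Z +
   r%:Z * (\sum_(i < r) binz2 (k i)) - (r * n)%N%:Z * (\sum_(i < r) k i)%N%:Z =
  r%:Z * (\sum_(i < r) binz2 (box_shift k i)) - 'C((r * n).+1, 2)%:Z.
Proof.
have h : 2 * \sum_(i < r) binz2 (k i) = 2 * \sum_(i < r) binz2 (box_shift k i) +
   2 * n%:Z * (\sum_(i < r) box_shift k i) + r%:Z * (n%:Z * (n%:Z - 1)).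
  rewrite !mulr_sumr.
  have -> : r%:Z * (n%:Z * (n%:Z - 1)) = \sum_(i < r) (n%:Z * (n%:Z - 1)).
    by rewrite sumr_const card_ord -mulr_natl natz.
  rewrite -!big_split; apply: eq_bigr => i _ /=.
  rewrite !binz2_double /box_shift; ring.
have hp := num_pairs r.
have hp' : 2 * (\sum_(i < r) \sum_(j < r | (i < j)%N) 1)%N%:Z = r%:Z * (r%:Z - 1).
  by rewrite -[2]/(Posz 2) -PoszM hp; case: (r) => //= s; rewrite PoszM; lia.
have hc : 2 * 'C((r * n).+1, 2)%:Z = ((r * n)%N%:Z + 1) * (r * n)%N%:Z.
  by rewrite -binz2_nat binz2_double; rewrite -addn1 PoszD addrK.
rewrite sum_box_shift in h.
apply: (@mulfI _ (2 : int)) => //.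
rewrite !mulrDr !mulrN mulrCA h (mulrCA _ r%:Z (\sum_(i < r) binz2 _)) hc.
rewrite [Posz (n * _)]PoszM [2 * (n%:Z * _)]mulrCA hp' PoszM.
by ring.
Qed.

Lemma bilateral_finite (a b z : F) : z != 0 ->
  \sum_(k : {ffun 'I_r -> 'I_(n + n).+1})
    theta_weight (box_shift k)
    * (-1) ^ (r%:Z * \sum_(i < r) box_shift k i)
    * z ^ (\sum_(i < r) box_shift k i) * box_factor k
    * (rothe_coef q (a * q ^+ (r * n)) b (\sum_(i < r) k i)
    * qpn q (r * (n + n) - \sum_(i < r) k i)
        (z * (a + b * q ^ (\sum_(i < r) box_shift k i)))) =
  (\prod_(i < r) \prod_(j < r) qpn q (n + n) (x i / x j * q)) *
  (qpn q (r * n) z * qpn q (r * n) (q / z)).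
Proof.
move=> z0; set L := (r * n)%N; set P := \prod_(i < r) _.
have P0 : P != 0.
  apply/prodf_neq0 => i _; apply/prodf_neq0 => j _.
  by rewrite qpn_gen_neq0.
have := milne_abel_rothe q_neq0 q_aper (n + n) x_neq0 x_gen (a * q ^+ L) b
   (z * q ^- L).
rewrite mulnDr -/L (qpn_reflect L z0) -/P => h.
pose kap := (- z) ^+ L * q ^ (- 'C(L.+1, 2)%:Z).
have kap0 : kap != 0 by rewrite mulf_neq0 ?expf_neq0 ?oppr_eq0 ?expfz_neq0.
(* [P ^+ 2] clears the Milne denominators and leaves one [P] on the product side; [kap] is the
   factor produced by [qpn_reflect]. *)
transitivity (P ^+ 2 / kap * (kap * (qpn q L z * qpn q L (q / z)) / P)).
  rewrite -h mulr_sumr; apply: eq_bigr => k _.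
  rewrite !mulrA; congr (_ * _); last first.
    congr (qpn q _ _); rewrite sum_box_shift -/L -mulrA; congr (_ * _).
    rewrite expfzDr // -exprnP -exprnN.
    by field; rewrite expf_neq0.
  congr (_ * _).
  have hG : box_factor k = P ^+ 2 * \prod_(i < r) \prod_(j < r)
     (qpn q (n + n - k i) (x j / x i * q) * qpn q (k i) (x i / x j * q))^-1.
    have -> : P ^+ 2 = (\prod_(i < r) \prod_(j < r) qpn q (n + n) (x j / x i * q)) * P.
      by rewrite expr2 {1}/P exchange_big.
    rewrite -!big_split; apply: eq_bigr => i _ /=.
    rewrite -!big_split; apply: eq_bigr => j _ /=.
    have lek : (k i <= n + n)%N by rewrite -ltnS.
    have := qpnD (n + n - k i) (k i) (x j / x i * q); rewrite subnK // => ->.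
    have := qpnD (k i) (n + n - k i) (x i / x j * q); rewrite subnKC // => ->.
    have n1 := qpn_gen_neq0 q_aper x_neq0 x_gen j i (n + n - k i).
    have n2 := qpn_gen_neq0 q_aper x_neq0 x_gen i j (k i).
    by field; rewrite n1 n2.
  rewrite hG /milne_term /milne_factor vdm_ratio_shift.
  have -> : \prod_(i < r) \prod_(j < r) ((- (x i / x j)) ^+ k i * q ^+ 'C(k i, 2) /
    (qpn q (n + n - k i) (x j / x i * q) * qpn q (k i) (x i / x j * q))) =
    (\prod_(i < r) \prod_(j < r) ((- (x i / x j)) ^+ k i * q ^+ 'C(k i, 2))) *
    \prod_(i < r) \prod_(j < r)
     (qpn q (n + n - k i) (x j / x i * q) * qpn q (k i) (x i / x j * q))^-1.
    by rewrite -big_split; apply: eq_bigr => i _ /=; rewrite -big_split.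
  rewrite sum_box_monomial /theta_weight.
  set V := \prod_(i < r) \prod_(j < r | _) _; set X := \prod_(i < r) x i ^ _.
  set W := \prod_(i < r) \prod_(j < r) _^-1; set K := (\sum_(i < r) k i)%N.
  set Np := (\sum_(i < r) \sum_(j < r | _) 1)%N.
  have hz : z ^ (\sum_(i < r) box_shift k i) * z ^+ L = z ^+ K.
    by rewrite !exprnP -expfzDr // sum_box_shift subrK.
  have hs : (-1) ^ (r%:Z * \sum_(i < r) box_shift k i) * (-1) ^+ L =
     (-1) ^+ (r * K) :> F.
    rewrite sum_box_shift mulrBr -!PoszM expfzDr ?oppr_eq0 ?oner_eq0 //.
    (* Since L = rn, the numbers rL and L have the same parity. *)
    have e : (-1) ^+ (r * L) = (-1) ^+ L :> F.
      by rewrite -signr_odd -[RHS]signr_odd /L !oddM; case: (odd r).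
    by rewrite -/K -exprnP -exprnN e divfK ?signr_eq0.
  have hq : q ^+ (n * Np) * q ^ (r%:Z * \sum_(i < r) binz2 (k i)) * q ^- (L * K) =
      q ^ (r%:Z * \sum_(i < r) binz2 (box_shift k i)) * q ^ (- 'C(L.+1, 2)%:Z).
    rewrite exprnP exprnN -!expfzDr //; congr (_ ^ _).
    have := bilateral_exponent k; rewrite -/L -/K -/Np => <-.
    by rewrite PoszM.
  have hc : (z * q ^- L) ^+ K = z ^+ K * q ^- (L * K).
    by rewrite exprMn -exprVn -exprM exprVn.
  rewrite hc -hz -hs.
  transitivity (P ^+ 2 / kap * V * X * W * (-1) ^ (r%:Z * \sum_(i < r) box_shift k i)
     * z ^ (\sum_(i < r) box_shift k i) * ((-1) ^+ L * z ^+ L) *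
     (q ^+ (n * Np) * q ^ (r%:Z * \sum_(i < r) binz2 (k i)) * q ^- (L * K)));
    last by ring.
  rewrite hq.
  have -> : (-1) ^+ L * z ^+ L = kap / q ^ (- 'C(L.+1, 2)%:Z).
    by rewrite -exprMn mulN1r /kap mulfK ?expfz_neq0.
  set e := q ^ _; set e' := q ^ (- _).
  have e'0 : e' != 0 by rewrite expfz_neq0.
  by field; rewrite kap0 e'0.
by field; rewrite kap0 P0.
Qed.

End Bilateral.

(** * The real-valued complex modulus *)

Local Notation nrm := Normc.normc.

Section ComplexModulus.

Variable R : realType.
Implicit Types x y : R[i].

Lemma nrmE x : `|x| = (nrm x)%:C.
Proof. by rewrite normc_def; case: x. Qed.

Lemma nrm_ge0 x : 0 <= nrm x.
Proof. by case: x => u v; exact: sqrtr_ge0. Qed.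

Lemma nrmD x y : nrm (x + y) <= nrm x + nrm y.
Proof. by rewrite -lecR rmorphD /= -!nrmE ler_normD. Qed.

Lemma nrmN x : nrm (- x) = nrm x.
Proof. by apply: (@complexI R); rewrite -!nrmE normrN. Qed.

Lemma nrmB x y : nrm (x - y) <= nrm x + nrm y.
Proof. by rewrite -(nrmN y) nrmD. Qed.

Lemma nrmC x y : nrm (x - y) = nrm (y - x).
Proof. by rewrite -nrmN opprB. Qed.

Lemma nrm_eq0 x : (nrm x == 0) = (x == 0).
Proof.
apply/eqP/eqP => [/Normc.eq0_normc //|->]; exact: Normc.normc0.
Qed.

Lemma nrm_gt0 x : x != 0 -> 0 < nrm x.
Proof. by move=> x0; rewrite lt_def nrm_eq0 x0 nrm_ge0. Qed.

Lemma nrmX x n : nrm (x ^+ n) = nrm x ^+ n.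
Proof.
elim: n => [|n IH]; first exact: Normc.normc1.
by rewrite !exprS Normc.normcM IH.
Qed.

Lemma nrmXz x (n : int) : nrm (x ^ n) = nrm x ^ n.
Proof.
case: n => n; first exact: nrmX.
by rewrite NegzE -!exprnN Normc.normcV nrmX.
Qed.

Lemma nrm_prod I (s : seq I) (P : pred I) (f : I -> R[i]) :
  nrm (\prod_(i <- s | P i) f i) = \prod_(i <- s | P i) nrm (f i).
Proof.
elim: s => [|i s IH]; rewrite ?big_nil ?big_cons; first exact: Normc.normc1.
by case: ifP => // _; rewrite Normc.normcM IH.
Qed.

Lemma nrm_sum I (s : seq I) (P : pred I) (f : I -> R[i]) :
  nrm (\sum_(i <- s | P i) f i) <= \sum_(i <- s | P i) nrm (f i).
Proof.
elim/big_ind2 : _ => [|x u y v hx hy|//]; first by rewrite Normc.normc0.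
by rewrite (le_trans (nrmD _ _)) // lerD.
Qed.

End ComplexModulus.

(** * Limits of complex sequences *)

Section ComplexLimits.

Variable R : realType.

(** Stated with a real epsilon and the real-valued modulus, so that estimates stay in [R];
    [cvgc_lim] is the bridge to the limit in [qpoch]. *)
Definition cvgc (u : nat -> R[i]) (l : R[i]) : Prop :=
  forall e : R, 0 < e -> exists N, forall n, (N <= n)%N -> nrm (u n - l) <= e.

Lemma cvgc_eventually u v l N :
  (forall n, (N <= n)%N -> u n = v n) -> cvgc u l -> cvgc v l.
Proof.
move=> uv cu e e0; have [M hM] := cu e e0.
exists (maxn N M) => n; rewrite geq_max => /andP[hN /hM].
by rewrite uv.
Qed.

Lemma cvgc_cst l : cvgc (fun=> l) l.
Proof.
by move=> e e0; exists 0%N => n _; rewrite subrr Normc.normc0 ltW.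
Qed.

Lemma cvgc_unique u l m : cvgc u l -> cvgc u m -> l = m.
Proof.
move=> cl cm; apply/eqP; rewrite -subr_eq0 -nrm_eq0; apply/eqP.
apply/eqP; rewrite eq_le nrm_ge0 andbT; apply/ler_addgt0Pr => e e0.
have e2 : 0 < e / 2 by lra.
have [N hN] := cl _ e2; have [M hM] := cm _ e2.
have := hN _ (leq_maxl N M); have := hM _ (leq_maxr N M).
set w := u _ => h1 h2; rewrite add0r.
have -> : l - m = (w - m) - (w - l) by ring.
by rewrite (le_trans (nrmB _ _)) //; lra.
Qed.

Lemma cvgcD u v l m : cvgc u l -> cvgc v m -> cvgc (fun n => u n + v n) (l + m).
Proof.
move=> cu cv e e0; have e2 : 0 < e / 2 by lra.
have [N hN] := cu _ e2; have [M hM] := cv _ e2.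
exists (maxn N M) => n; rewrite geq_max => /andP[/hN h1 /hM h2].
have -> : u n + v n - (l + m) = (u n - l) + (v n - m) by ring.
by rewrite (le_trans (nrmD _ _)) //; lra.
Qed.

Lemma cvgcM u v l m : cvgc u l -> cvgc v m -> cvgc (fun n => u n * v n) (l * m).
Proof.
move=> cu cv e e0.
have K0 : 0 < 1 + nrm l + nrm m by have := nrm_ge0 l; have := nrm_ge0 m; lra.
pose d := Num.min 1 (e / (1 + nrm l + nrm m)).
have d0 : 0 < d by rewrite lt_min ltr01 divr_gt0.
have d1 : d <= 1 by rewrite ge_min lexx.
have de : d * (1 + nrm l + nrm m) <= e.
  by rewrite -ler_pdivlMr // ge_min lexx orbT.
have [N hN] := cu _ d0; have [M hM] := cv _ d0.
exists (maxn N M) => n; rewrite geq_max => /andP[/hN h1 /hM h2].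
have -> : u n * v n - l * m =
    (u n - l) * (v n - m) + (l * (v n - m) + (u n - l) * m) by ring.
apply: le_trans (nrmD _ _) _; rewrite Normc.normcM.
apply: le_trans (lerD (lexx _) (nrmD _ _)) _; rewrite !Normc.normcM.
apply: le_trans de; rewrite !mulrDr mulr1 -addrA.
have := nrm_ge0 (u n - l); have := nrm_ge0 (v n - m).
move=> p1 p2; apply: lerD.
  by rewrite -[leRHS]mulr1 ler_pM // (le_trans h2).
by apply: lerD; first rewrite mulrC; rewrite ler_wpM2r ?nrm_ge0.
Qed.

Lemma cvgc_prod I (s : seq I) (P : pred I) (u : I -> nat -> R[i]) (l : I -> R[i]) :
  (forall i, P i -> cvgc (u i) (l i)) ->
  cvgc (fun n => \prod_(i <- s | P i) u i n) (\prod_(i <- s | P i) l i).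
Proof.
move=> cu; elim: s => [|i s IH].
  by under eq_fun do rewrite big_nil; rewrite big_nil; exact: cvgc_cst.
under eq_fun do rewrite big_cons; rewrite big_cons.
by case: ifP => // Pi; apply: cvgcM => //; exact: cu.
Qed.

Lemma cvgc_sum I (s : seq I) (P : pred I) (u : I -> nat -> R[i]) (l : I -> R[i]) :
  (forall i, P i -> cvgc (u i) (l i)) ->
  cvgc (fun n => \sum_(i <- s | P i) u i n) (\sum_(i <- s | P i) l i).
Proof.
move=> cu; elim: s => [|i s IH].
  by under eq_fun do rewrite big_nil; rewrite big_nil; exact: cvgc_cst.
under eq_fun do rewrite big_cons; rewrite big_cons.
by case: ifP => // Pi; apply: cvgcD => //; exact: cu.
Qed.

Lemma cvgc_comp u l (f : nat -> nat) c : (forall n, (n <= f n + c)%N) ->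
  cvgc u l -> cvgc (fun n => u (f n)) l.
Proof.
move=> hf cu e e0; have [N hN] := cu e e0; exists (N + c)%N => n Nn.
by apply: hN; have := hf n; lia.
Qed.

Lemma cvgc_nrm_le u l (B : R) : cvgc u l ->
  (exists N, forall n, (N <= n)%N -> nrm (u n) <= B) -> nrm l <= B.
Proof.
move=> cu [N hN]; apply/ler_addgt0Pr => e e0.
have [M hM] := cu e e0.
have h1 := hN _ (leq_maxl N M); have h2 := hM _ (leq_maxr N M).
set w := u _ in h1 h2; have -> : l = w - (w - l) by ring.
by rewrite (le_trans (nrmB _ _)) // lerD.
Qed.

Lemma cvgc_lim u l : cvgc u l -> limn (u : nat -> R[i]^o) = l.
Proof.
move=> cu; apply: (@cvg_lim R[i]^o); first exact: norm_hausdorff.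
apply/cvgrPdist_le => e e0.
have eR : e = (complex.Re e)%:C.
  move: (ltW e0); rewrite lecE /= => /andP[/eqP h _].
  by case: e e0 h => u' v' _ /= ->.
have e0' : 0 < complex.Re e by move: e0; rewrite {1}eR ltcR.
have [N hN] := cu _ e0'; near=> n.
rewrite eR nrmE lecR nrmC; apply: hN.
by near: n; exact: nbhs_infty_ge.
Unshelve. all: by end_near.
Qed.

Lemma geom_cauchy_cvg (v : nat -> R) (B Q : R) : 0 <= Q < 1 ->
  (forall n, `|v n.+1 - v n| <= B * Q ^+ n) -> cvgn v.
Proof.
move=> /andP[Q0 Q1] hv.
have B0 : 0 <= B by have := hv 0%N; rewrite expr0 mulr1; apply: le_trans.
have cs : cvgn (series (telescope v)).
  apply: normed_cvg; apply: (@series_le_cvg _ _ (geometric B Q)).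
  - by move=> n; exact: normr_ge0.
  - by move=> n; rewrite /geometric /= mulr_ge0 ?exprn_ge0.
  - by move=> n; exact: hv.
  - by apply: is_cvg_geometric_series; rewrite ger0_norm.
have -> : v = (fun n => series (telescope v) n + v 0%N).
  by apply/funext => n; rewrite /series /= telescope_sumr // subrK.
by apply: is_cvgD => //; exact: is_cvg_cst.
Qed.

Lemma geom_cauchy_cvgc (u : nat -> R[i]) (B Q : R) : 0 <= Q < 1 ->
  (forall n, nrm (u n.+1 - u n) <= B * Q ^+ n) -> exists l, cvgc u l.
Proof.
move=> hQ hu.
have hRe (w : R[i]) : `|complex.Re w| <= nrm w.
  by rewrite -lecR -nrmE normc_ge_Re.
have hIm (w : R[i]) : `|complex.Im w| <= nrm w.
  case: w => s t /=; rewrite -sqrtr_sqr ler_sqrt ?addr_ge0 ?sqr_ge0 //.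
  by rewrite lerDr sqr_ge0.
have c1 : cvgn (fun n => complex.Re (u n)).
  apply: (geom_cauchy_cvg hQ) => n; rewrite -raddfB.
  by apply: le_trans (hRe _) (hu n).
have c2 : cvgn (fun n => complex.Im (u n)).
  apply: (geom_cauchy_cvg hQ) => n; rewrite -raddfB.
  by apply: le_trans (hIm _) (hu n).
exists (limn (fun n => complex.Re (u n)) +i* limn (fun n => complex.Im (u n))).
move=> e e0; have e2 : 0 < e / 2 by lra.
move/cvgrPdist_le : c1 => /(_ _ e2) [N _ hN].
move/cvgrPdist_le : c2 => /(_ _ e2) [M _ hM].
exists (maxn N M) => n; rewrite geq_max => /andP[/hN h1 /hM h2].
have nrm_le (w : R[i]) : nrm w <= `|complex.Re w| + `|complex.Im w|.
  case: w => s t /=.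
  rewrite -(ger0_norm (addr_ge0 (normr_ge0 s) (normr_ge0 t))) -sqrtr_sqr.
  rewrite ler_sqrt ?sqr_ge0 // sqrrD !real_normK ?num_real //.
  by rewrite addrAC lerDl mulrn_wge0 // mulr_ge0.
apply: le_trans (nrm_le _) _; rewrite !raddfB /= in h1 h2 *.
by rewrite distrC in h1; rewrite distrC in h2; lra.
Qed.

End ComplexLimits.

(** * Uniform bounds and limits of q-Pochhammer symbols *)

Section QPochhammer.

Variables (R : realType) (q : R[i]).
Hypothesis q_lt1 : nrm q < 1.

(** As 1 + s <= exp s, the exponential of the full geometric series t + t|q| + t|q|^2 + ... bounds
    the products of the 1 + t|q|^j of every length. *)
Definition qexp_bound (t : R) : R := expR (t / (1 - nrm q)).

Let Q0 : 0 <= nrm q := nrm_ge0 q.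
Let Q1 : 0 < 1 - nrm q. Proof. by rewrite subr_gt0. Qed.

Lemma qexp_bound_gt0 t : 0 < qexp_bound t. Proof. exact: expR_gt0. Qed.

Lemma qexp_bound_le s t : s <= t -> qexp_bound s <= qexp_bound t.
Proof. by move=> st; rewrite ler_expR ler_pM2r ?invr_gt0. Qed.

Lemma prod1D_le (t : R) n : 0 <= t ->
  \prod_(j < n) (1 + t * nrm q ^+ j) <= qexp_bound t.
Proof.
move=> t0.
(* The induction needs the exact partial geometric sum in the exponent. *)
have h : \prod_(j < n) (1 + t * nrm q ^+ j) <=
    expR (t * (1 - nrm q ^+ n) / (1 - nrm q)).
  elim: n => [|n IH]; first by rewrite big_ord0 expr0 subrr mulr0 mul0r expR0.
  rewrite big_ord_recr /=.
  have -> : t * (1 - nrm q ^+ n.+1) / (1 - nrm q) =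
      t * (1 - nrm q ^+ n) / (1 - nrm q) + t * nrm q ^+ n.
    by rewrite exprS; field; rewrite lt0r_neq0.
  rewrite expRD ler_pM // ?expR_ge1Dx //.
    by apply: prodr_ge0 => j _; rewrite addr_ge0 ?mulr_ge0 ?exprn_ge0.
  by rewrite addr_ge0 ?mulr_ge0 ?exprn_ge0.
apply: le_trans h _; rewrite ler_expR ler_pM2r ?invr_gt0 //.
by rewrite -[leRHS]mulr1 ler_wpM2l // gerBl exprn_ge0.
Qed.

Lemma nrm_qpn_le n (x : R[i]) (t : R) : nrm x <= t ->
  nrm (qpn q n x) <= qexp_bound t.
Proof.
move=> xt; apply: le_trans (qexp_bound_le xt).
apply: le_trans (prod1D_le n (nrm_ge0 x)); rewrite nrm_prod.
apply: ler_prod => j _; rewrite nrm_ge0 /=.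
by apply: le_trans (nrmB _ _) _; rewrite Normc.normc1 Normc.normcM nrmX.
Qed.

Lemma nrm_qpnS n (x : R[i]) :
  nrm (qpn q n.+1 x - qpn q n x) <= qexp_bound (nrm x) * nrm x * nrm q ^+ n.
Proof.
have -> : qpn q n.+1 x - qpn q n x = - (qpn q n x * x * q ^+ n).
  by rewrite /qpn big_ord_recr /=; ring.
rewrite nrmN !Normc.normcM nrmX ler_wpM2r ?exprn_ge0 // ler_wpM2r ?nrm_ge0 //.
exact: nrm_qpn_le.
Qed.

(** Sums the increments [nrm_qpnS]. The bound vanishes with x uniformly in n, as needed when length
    and argument vary together. *)
Lemma nrm_qpn_sub1 n (x : R[i]) :
  nrm (qpn q n x - 1) <= qexp_bound (nrm x) * nrm x / (1 - nrm q).
Proof.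
set B := qexp_bound _ * _.
have B0 : 0 <= B by rewrite mulr_ge0 ?nrm_ge0 // ltW ?qexp_bound_gt0.
suff h : nrm (qpn q n x - 1) <= B * (1 - nrm q ^+ n) / (1 - nrm q).
  apply: le_trans h _; rewrite ler_pM2r ?invr_gt0 //.
  by rewrite -[leRHS]mulr1 ler_wpM2l // gerBl exprn_ge0.
elim: n => [|n IH].
  by rewrite /qpn big_ord0 subrr Normc.normc0 expr0 subrr mulr0 mul0r.
have -> : qpn q n.+1 x - 1 = (qpn q n.+1 x - qpn q n x) + (qpn q n x - 1) by ring.
apply: le_trans (nrmD _ _) _; apply: le_trans (lerD (nrm_qpnS n x) IH) _.
rewrite -/B le_eqVlt; apply/orP; left; apply/eqP.
by rewrite exprS; field; rewrite lt0r_neq0.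
Qed.

Lemma cvgc_qpn (x : R[i]) : cvgc (fun n => qpn q n x) (qpoch q x).
Proof.
have hQ : 0 <= nrm q < 1 by rewrite Q0.
have [l cl] := geom_cauchy_cvgc hQ (nrm_qpnS^~ x).
suff -> : qpoch q x = l by [].
have e : (fun n : nat => \prod_(0 <= j < n) (1 - x * q ^+ j) : R[i]^o) =
    (fun n => qpn q n x) by apply/funext => n; rewrite big_mkord.
by rewrite /qpoch e; exact: cvgc_lim.
Qed.

Lemma cvgc_geom (c : R[i]) : cvgc (fun n => c * q ^+ n) 0.
Proof.
move=> e e0.
have : ((fun n => nrm c * nrm q ^+ n) @ \oo --> (0 : R))%classic.
  by apply: cvg_geometric; rewrite ger0_norm.
move/cvgrPdist_le => /(_ _ e0) [N _ hN]; exists N => n /hN.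
by rewrite sub0r normrN subr0 Normc.normcM nrmX ger0_norm // mulr_ge0 ?nrm_ge0 ?exprn_ge0.
Qed.

Lemma cvgc_qpn_small (v : nat -> R[i]) (L : nat -> nat) :
  cvgc v 0 -> cvgc (fun n => qpn q (L n) (v n)) 1.
Proof.
move=> cv e e0.
pose K := qexp_bound 1 / (1 - nrm q).
have K0 : 0 < K by rewrite divr_gt0 // qexp_bound_gt0.
pose d := Num.min 1 (e / K).
have d0 : 0 < d by rewrite lt_min ltr01 divr_gt0.
have [N hN] := cv _ d0; exists N => n /hN; rewrite subr0 => h.
have h1 : nrm (v n) <= 1 by apply: le_trans h _; rewrite ge_min lexx.
have h2 : nrm (v n) <= e / K by apply: le_trans h _; rewrite ge_min lexx orbT.
apply: le_trans (nrm_qpn_sub1 _ _) _.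
apply: (@le_trans _ _ (K * nrm (v n))).
  rewrite /K [leRHS]mulrAC ler_pM2r ?invr_gt0 // ler_wpM2r ?nrm_ge0 //.
  exact: qexp_bound_le.
by rewrite mulrC -ler_pdivlMr.
Qed.

End QPochhammer.

(** * Dominated summation over the integer lattice *)

Section Tannery.

Variables (R : realType) (r : nat).
Let T := {ffun 'I_r -> int}.

Definition l1 (k : {ffun 'I_r -> int}) : nat := (\sum_(i < r) `|k i|)%N.

Definition boxz n (k : {ffun 'I_r -> 'I_(n + n).+1}) : {ffun 'I_r -> int} :=
  [ffun i => box_shift k i].

Lemma boxz_inj n : injective (@boxz n).
Proof.
move=> k l /ffunP h; apply/ffunP => i; apply/val_inj.
by have := h i; rewrite !ffunE /box_shift => /addIr [].
Qed.

Definition boxset n : {fset {ffun 'I_r -> int}} :=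
  seq_fset tt [seq boxz k | k <- enum {: {ffun 'I_r -> 'I_(n + n).+1}}].

Lemma mem_boxset n (k : T) :
  reflect (forall i, (`|k i| <= n)%N) (k \in boxset n).
Proof.
rewrite seq_fsetE; apply: (iffP mapP) => [[l _ ->] i|h].
  by rewrite ffunE /box_shift; case: (l i) => m /= hm; lia.
exists [ffun i => inord `|k i + n%:Z|]; first by rewrite mem_enum.
apply/ffunP => i; have hi : (`|k i| <= n)%N := h i.
by rewrite ffunE /box_shift ffunE inordK; move: (k i) hi => w; lia.
Qed.

Lemma sum_boxset (V : nmodType) n (G : T -> V) :
  \sum_(k <- boxset n) G k = \sum_(k : {ffun 'I_r -> 'I_(n + n).+1}) G (boxz k).
Proof.
rewrite (perm_big [seq boxz k | k <- enum {: {ffun 'I_r -> 'I_(n + n).+1}}]).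
  by rewrite big_map big_enum.
apply: uniq_perm (fset_uniq _) _ (seq_fsetE tt _).
by rewrite map_inj_uniq ?enum_uniq //; exact: boxz_inj.
Qed.

Lemma sum_fset_split (I : choiceType) (V : nmodType) (A B : {fset I})
    (G : I -> V) : (A `<=` B)%fset ->
  \sum_(k <- B) G k = \sum_(k <- A) G k + \sum_(k <- B | k \notin A) G k.
Proof.
move=> AB; rewrite (bigID (mem A)) /=; congr (_ + _).
rewrite big_fset_condE; congr (\sum_(i <- _) _).
apply/congr1/fsetP => k; rewrite !inE /= andb_idl // => kA.
exact: (fsubsetP AB).
Qed.

Variable rho : R.
Hypothesis rho01 : 0 < rho < 1.

Let rho_gt0 : 0 < rho. Proof. by case/andP: rho01. Qed.
Let rho_lt1 : rho < 1. Proof. by case/andP: rho01. Qed.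

Let rho_decr m n : (m <= n)%N -> rho ^+ n <= rho ^+ m.
Proof. by apply: ler_wiXn2l; exact: ltW. Qed.

(** A bound for every finite sum of the [rho ^+ l1 k]: each coordinate contributes at most two
    geometric series. *)
Definition box_mass : R := (2 / (1 - rho)) ^+ r.

Lemma geom_le n : \sum_(0 <= j < n) rho ^+ j <= (1 - rho)^-1.
Proof.
have h : 0 < 1 - rho by rewrite subr_gt0.
rewrite -[leRHS]mul1r ler_pdivlMr // big_mkord mulrC.
have -> : (1 - rho) * \sum_(i < n) rho ^+ i = 1 - rho ^+ n.
  by rewrite -[1 - rho]opprB mulNr -subrX1 opprB.
by rewrite gerBl exprn_ge0 // ltW.
Qed.

Lemma geom_abs_le n :
  \sum_(s < (n + n).+1) rho ^+ `|s%:Z - n%:Z|%N <= 2 / (1 - rho).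
Proof.
rewrite -(big_mkord predT (fun s => rho ^+ `|s%:Z - n%:Z|%N)).
rewrite (big_cat_nat (n := n)) //=; last by lia.
rewrite mulr2n mulrDl mul1r; apply: lerD.
  apply: le_trans (geom_le n); rewrite [leLHS]big_nat_rev /= add0n.
  rewrite big_nat [leRHS]big_nat; apply: ler_sum => j /andP[_ jn].
  have -> : `|(n - j.+1)%:Z - n%:Z|%N = j.+1 by lia.
  by rewrite exprS -[leRHS]mul1r ler_wpM2r ?exprn_ge0 // ltW.
apply: le_trans (geom_le n.+1); rewrite -{1}[n]add0n big_addn.
have -> : ((n + n).+1 - n = n.+1)%N by lia.
by apply: ler_sum => j _; have -> : `|(j + n)%N%:Z - n%:Z|%N = j by lia.
Qed.

Lemma sum_boxset_le n : \sum_(k <- boxset n) rho ^+ l1 k <= box_mass.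
Proof.
rewrite sum_boxset.
have -> : \sum_(k : {ffun 'I_r -> 'I_(n + n).+1}) rho ^+ l1 (boxz k) =
   \prod_(i < r) \sum_(s < (n + n).+1) rho ^+ `|s%:Z - n%:Z|%N.
  rewrite bigA_distr_bigA /=; apply: eq_bigr => k _.
  by rewrite /l1 expr_sum; apply: eq_bigr => i _; rewrite ffunE.
rewrite /box_mass -[r in _ ^+ r]card_ord -prodr_const; apply: ler_prod => i _.
rewrite geom_abs_le andbT; apply: sumr_ge0 => s _.
by rewrite exprn_ge0 // ltW.
Qed.

Lemma fset_sub_box (B : {fset T}) : exists n, (B `<=` boxset n)%fset.
Proof.
exists (\sum_(k <- B) l1 k)%N; apply/fsubsetP => k kB; apply/mem_boxset => i.
rewrite (big_fsetD1 k) //= {1}/l1 (bigD1 i) //=; lia.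
Qed.

Lemma sum_fset_le (B : {fset T}) : \sum_(k <- B) rho ^+ l1 k <= box_mass.
Proof.
have [n Bn] := fset_sub_box B; apply: le_trans (sum_boxset_le n).
rewrite [leRHS](sum_fset_split _ Bn) lerDl; apply: sumr_ge0 => k _.
by rewrite exprn_ge0 // ltW.
Qed.

Lemma l1_notin_box K (k : T) : k \notin boxset K -> (K <= l1 k)%N.
Proof.
move=> kK; have [i hi] : exists i, (K < `|k i|)%N.
  apply/not_existsP => h; move/mem_boxset: kK; apply => i.
  by rewrite leqNgt; apply/negP/h.
by rewrite /l1 (bigD1 i) //=; lia.
Qed.

Variables (C : R).
Hypothesis C_ge0 : 0 <= C.

(** The exponent [2 * l1 k] is split in halves: outside the box of radius K one half gives at most
    rho^K, and the other keeps the sum bounded by [box_mass]. *)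
Lemma tail_le (G : T -> R[i]) K (B : {fset T}) :
  (forall k, k \in B -> nrm (G k) <= C * rho ^+ (2 * l1 k)) ->
  \sum_(k <- B | k \notin boxset K) nrm (G k) <= C * rho ^+ K * box_mass.
Proof.
move=> hG.
apply: (@le_trans _ _ (\sum_(k <- B | k \notin boxset K) C * rho ^+ K * rho ^+ l1 k)).
  rewrite big_seq_cond [leRHS]big_seq_cond; apply: ler_sum => k /andP[kB kK].
  apply: le_trans (hG k kB) _; rewrite -mulrA ler_wpM2l // mulSn mul1n exprD.
  by rewrite ler_wpM2r ?exprn_ge0 ?(ltW rho_gt0) // rho_decr // l1_notin_box.
rewrite -mulr_sumr ler_wpM2l ?mulr_ge0 ?exprn_ge0 ?(ltW rho_gt0) //.
apply: le_trans (sum_fset_le B).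
rewrite [leRHS](bigID (fun k => k \notin boxset K)) /= lerDl.
by apply: sumr_ge0 => k _; rewrite exprn_ge0 // ltW.
Qed.

Lemma tail_small e : 0 < e -> exists K, C * rho ^+ K * box_mass <= e.
Proof.
move=> e0.
have : ((fun n => (C * box_mass) * rho ^+ n) @ \oo --> (0 : R))%classic.
  by apply: cvg_geometric; rewrite ger0_norm // ltW.
move/cvgrPdist_le => /(_ _ e0) [N _ hN]; exists N.
have := hN N (leqnn N); rewrite sub0r normrN => h.
by apply: le_trans h; rewrite mulrAC ler_norm.
Qed.

Variable g : T -> R[i].

Lemma abs_summable_dominated :
  (forall k, nrm (g k) <= C * rho ^+ (2 * l1 k)) -> abs_summable g.
Proof.
move=> hg; rewrite /abs_summable /summable.
apply: (@le_lt_trans _ _ (C * box_mass)%:E); last exact: ltry.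
apply: ge_ereal_sup => _ [A [finA _] <-].
rewrite fsbig_finite //=.
rewrite (eq_bigr (fun k => (nrm (g k))%:E)); last first.
  by move=> k _; rewrite /= ger0_norm ?nrm_ge0.
rewrite sumEFin lee_fin.
apply: le_trans (ler_wpM2l C_ge0 (sum_fset_le (fset_set A))).
rewrite mulr_sumr; apply: ler_sum => k _; apply: le_trans (hg k) _.
by rewrite ler_wpM2l // rho_decr //; lia.
Qed.

Lemma tannery (f : nat -> T -> R[i]) (S : nat -> R[i]) (l : R[i]) :
  (forall n (k : T), (forall i, (`|k i| <= n)%N) ->
     nrm (f n k) <= C * rho ^+ (2 * l1 k)) ->
  (forall k, nrm (g k) <= C * rho ^+ (2 * l1 k)) ->
  (forall k, cvgc (fun n => f n k) (g k)) ->
  (forall n, \sum_(k <- boxset n) f n k = S n) ->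
  cvgc S l -> sums_to g l.
Proof.
(* Four errors of at most e/5 each leave a strict inequality: [f n] against [g] on a fixed box,
   [S n] against [l], the tail of [g] on [B], and the tail of [f n] on the large box. *)
move=> hf hg fg fS Sl e e0; have e5 : 0 < e / 5 by lra.
have [K hK] := tail_small e5; exists (boxset K) => B KB.
have [N1 hN1] := @cvgc_sum R _ (boxset K) predT (fun k n => f n k) g
   (fun k _ => fg k) _ e5.
have [N2 hN2] := Sl _ e5.
pose n := maxn K (maxn N1 N2).
have Kn : (boxset K `<=` boxset n)%fset.
  apply/fsubsetP => k /mem_boxset h; apply/mem_boxset => i.
  exact: leq_trans (h i) (leq_maxl _ _).
have h1 : nrm (\sum_(k <- boxset K) f n k - \sum_(k <- boxset K) g k) <= e / 5.
  by apply: hN1; rewrite /n; lia.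
have h2 : nrm (S n - l) <= e / 5 by apply: hN2; rewrite /n; lia.
have h3 : nrm (\sum_(k <- B | k \notin boxset K) g k) <= e / 5.
  apply: le_trans (nrm_sum _ _ _) _; apply: le_trans hK.
  by apply: tail_le => k _; exact: hg.
have h4 : nrm (\sum_(k <- boxset n | k \notin boxset K) f n k) <= e / 5.
  apply: le_trans (nrm_sum _ _ _) _; apply: le_trans hK.
  by apply: tail_le => k /mem_boxset; exact: hf.
have hS := fS n; rewrite (sum_fset_split _ Kn) in hS.
rewrite (sum_fset_split _ KB).
set a1 := \sum_(k <- boxset K) g k in h1 *.
set a2 := \sum_(k <- boxset K) f n k in h1 hS.
set a3 := \sum_(k <- B | _) _ in h3 *.
set a4 := \sum_(k <- boxset n | _) _ in h4 hS.
have -> : a1 + a3 - l = a3 + (a1 - a2) + ((S n - l) - a4).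
  by rewrite -hS; ring.
apply: le_lt_trans (nrmD _ _) _.
have := nrmD a3 (a1 - a2); have := nrmB (S n - l) a4; rewrite (nrmC a1).
by lra.
Qed.

Lemma sums_to0_involution (s : T -> T) :
  (forall k, nrm (g k) <= C * rho ^+ (2 * l1 k)) ->
  involutive s -> (forall k, g (s k) = - g k) -> sums_to g 0.
Proof.
move=> hg sK gs e e0; have e2 : 0 < e / 2 by lra.
have [K hK] := tail_small e2.
(* The involution need not preserve the box, so the box is completed to an invariant finite set, on
   which the sum equals its own negative. *)
pose A : {fset T} := (boxset K `|` [fset s k | k in boxset K])%fset.
have As k : (s k \in A) = (k \in A).
  have h l : l \in A -> s l \in A.
    rewrite !inE => /orP[lK|/imfsetP[m /= mK ->]].
      by apply/orP; right; apply/imfsetP; exists l.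
    by rewrite sK mK.
  by apply/idP/idP => [/h|/h //]; rewrite sK.
exists A => B AB; rewrite (sum_fset_split _ AB) subr0.
have -> : \sum_(k <- A) g k = 0.
  have h : \sum_(k <- A) g k = - \sum_(k <- A) g k.
    rewrite -sumrN (perm_big [seq s k | k <- A]) /=.
      by rewrite big_map; apply: eq_bigr => k _.
    apply: uniq_perm; rewrite ?fset_uniq //.
      by rewrite map_inj_uniq ?fset_uniq //; exact: inv_inj.
    move=> k; apply/idP/mapP => [kA|[m mA ->]]; last by rewrite As.
    by exists (s k); rewrite ?As ?sK.
  have : (\sum_(k <- A) g k) *+ 2 == 0 by rewrite mulr2n {1}h addNr.
  by rewrite mulrn_eq0 => /eqP.
rewrite add0r; apply: le_lt_trans (nrm_sum _ _ _) _.
apply: (@le_lt_trans _ _ (\sum_(k <- B | k \notin boxset K) nrm (g k))).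
  rewrite [leLHS]big_mkcond [leRHS]big_mkcond; apply: ler_sum => k _.
  have [_|kA] := boolP (k \in A) => /=; first by case: ifP => // _; exact: nrm_ge0.
  by move: kA; rewrite inE negb_or => /andP[-> _].
have := @tail_le g K B (fun k _ => hg k); lra.
Qed.

End Tannery.

(** * Factorization of the weight over pairs *)

Lemma big_pairs (V : Type) (idx : V) (op : Monoid.com_law idx) r
    (G : 'I_r -> 'I_r -> V) :
  \big[op/idx]_(i < r) \big[op/idx]_(j < r) G i j =
  op (\big[op/idx]_(i < r) G i i)
     (\big[op/idx]_(i < r) \big[op/idx]_(j < r | (i < j)%N) op (G i j) (G j i)).
Proof.
have -> : \big[op/idx]_(i < r) \big[op/idx]_(j < r | (i < j)%N) op (G i j) (G j i) =
  op (\big[op/idx]_(i < r) \big[op/idx]_(j < r | (i < j)%N) G i j)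
     (\big[op/idx]_(i < r) \big[op/idx]_(j < r | (j < i)%N) G i j).
  rewrite [X in _ = op _ X](exchange_big_dep predT) //= -big_split.
  by apply: eq_bigr => i _; rewrite big_split.
rewrite -!big_split; apply: eq_bigr => i _ /=.
rewrite (bigD1 i) //=; congr (op _ _).
rewrite (bigID (fun j : 'I_r => (i < j)%N)) /=; congr (op _ _); apply: eq_bigl => j;
  by rewrite -val_eqE /=; case: ltngtP.
Qed.

Section PairFactors.

Variables (F : fieldType) (q : F).
Hypothesis q_neq0 : q != 0.

Definition pair_factor (u v : F) (d : int) : F :=
  (u * q ^ d - v) / (u - v) * (u / v) ^ d * q ^ binz2 d.

(** The powers of x_i use r k_i - N = sum over j of (k_i - k_j), those of q use r (sum of k_i^2) =
    N^2 + sum over i < j of (k_i - k_j)^2. The terms linear in k are balanced by pulling q^(k_j) out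
    of each difference x_i q^(k_i) - x_j q^(k_j). *)
Lemma theta_weight_pairs r (x : 'I_r -> F) (k : 'I_r -> int) :
  (forall i, x i != 0) ->
  theta_weight q x k = q ^ binz2 (\sum_(i < r) k i) *
   \prod_(i < r) \prod_(j < r | (i < j)%N) pair_factor (x i) (x j) (k i - k j).
Proof.
move=> x0; rewrite /theta_weight; set N := \sum_(i < r) k i.
have hV : \prod_(i < r) \prod_(j < r | (i < j)%N)
     ((x i * q ^ k i - x j * q ^ k j) / (x i - x j)) =
   q ^ (\sum_(i < r) \sum_(j < r | (i < j)%N) k j) *
   \prod_(i < r) \prod_(j < r | (i < j)%N)
     ((x i * q ^ (k i - k j) - x j) / (x i - x j)).
  rewrite -prod_exprz // -big_split; apply: eq_bigr => i _ /=.
  rewrite -prod_exprz // -big_split; apply: eq_bigr => j _ /=.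
  have -> : q ^ k i = q ^ k j * q ^ (k i - k j).
    by rewrite -expfzDr //; congr (_ ^ _); ring.
  by ring.
have hX : \prod_(i < r) x i ^ (r%:Z * k i - N) =
   \prod_(i < r) \prod_(j < r | (i < j)%N) (x i / x j) ^ (k i - k j).
  transitivity (\prod_(i < r) \prod_(j < r) x i ^ (k i - k j)).
    apply: eq_bigr => i _; rewrite prod_exprz //; congr (_ ^ _).
    by rewrite big_split /= sumrN sumr_const card_ord -mulr_natl natz.
  rewrite big_pairs /= big1 ?mul1r => [|i _]; last by rewrite subrr.
  apply: eq_bigr => i _; apply: eq_bigr => j _ /=.
  by rewrite expfzMl exprz_inv opprB.
have hQ : q ^ (\sum_(i < r) \sum_(j < r | (i < j)%N) k j) *
    q ^ (r%:Z * \sum_(i < r) binz2 (k i)) =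
   q ^ binz2 N * \prod_(i < r) \prod_(j < r | (i < j)%N) q ^ binz2 (k i - k j).
  have -> : \prod_(i < r) \prod_(j < r | (i < j)%N) q ^ binz2 (k i - k j) =
      q ^ (\sum_(i < r) \sum_(j < r | (i < j)%N) binz2 (k i - k j)).
    by rewrite -prod_exprz //; apply: eq_bigr => i _; rewrite prod_exprz.
  rewrite -!expfzDr //; congr (_ ^ _).
  apply: (@mulfI _ (2 : int)) => //.
  rewrite !mulrDr binz2_double mulrCA !mulr_sumr.
  have -> : \sum_(i < r) r%:Z * (2 * binz2 (k i)) =
      \sum_(i < r) r%:Z * (k i * (k i - 1)).
    by apply: eq_bigr => i _; rewrite binz2_double.
  (* Evaluating this double sum once over all (i, j) and once by pairs i < j yields the identity of
     the exponents. *)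
  have h : \sum_(i < r) \sum_(j < r) (k i * k i - k i * k j - k i) =
     - N + \sum_(i < r) \sum_(j < r | (i < j)%N)
       ((k i * k i - k i * k j - k i) + (k j * k j - k j * k i - k j)).
    rewrite big_pairs /=; congr (_ + _).
    by rewrite /N -sumrN; apply: eq_bigr => i _; ring.
  have h1 : \sum_(i < r) \sum_(j < r) (k i * k i - k i * k j - k i) =
     \sum_(i < r) r%:Z * (k i * (k i - 1)) - N * N.
    rewrite [N * N]mulr_suml -sumrN -big_split; apply: eq_bigr => i _ /=.
    rewrite !big_split /= !sumrN !sumr_const card_ord -mulr_sumr -/N.
    have mn (w : int) : w *+ r = r%:Z * w by rewrite -mulr_natl natz.
    by rewrite !mn; ring.
  have h2 : \sum_(i < r) \sum_(j < r | (i < j)%N)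
       ((k i * k i - k i * k j - k i) + (k j * k j - k j * k i - k j)) =
     (\sum_(i < r) 2 * (\sum_(j < r | (i < j)%N) binz2 (k i - k j))) -
     (\sum_(i < r) 2 * (\sum_(j < r | (i < j)%N) k j)).
    rewrite -sumrN -big_split; apply: eq_bigr => i _ /=.
    rewrite !mulr_sumr -sumrN -big_split; apply: eq_bigr => j _ /=.
    by rewrite binz2_double; ring.
  move: h; rewrite h1 h2; move: (\sum_(i < r) r%:Z * _) => S1.
  move: (\sum_(i < r) 2 * (\sum_(j < r | _) binz2 _)) => S2.
  move: (\sum_(i < r) 2 * (\sum_(j < r | _) k j)) => S3.
  move=> h; rewrite mulrBr mulr1; apply/eqP; rewrite -subr_eq0; apply/eqP.
  transitivity (S1 - N * N - (- N + (S2 - S3))); first by ring.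
  by rewrite h subrr.
rewrite hV hX mulrAC.
transitivity ((q ^ (\sum_(i < r) \sum_(j < r | (i < j)%N) k j) *
    q ^ (r%:Z * \sum_(i < r) binz2 (k i))) *
  ((\prod_(i < r) \prod_(j < r | (i < j)%N)
     ((x i * q ^ (k i - k j) - x j) / (x i - x j))) *
  \prod_(i < r) \prod_(j < r | (i < j)%N) (x i / x j) ^ (k i - k j))).
  by ring.
rewrite hQ -mulrA; congr (_ * _); rewrite -!big_split; apply: eq_bigr => i _ /=.
rewrite -!big_split; apply: eq_bigr => j _ /=.
by rewrite /pair_factor; ring.
Qed.

End PairFactors.

Lemma absz_sum (I : finType) (f : I -> int) :
  (absz (\sum_i f i)%R <= \sum_i absz (f i))%N.
Proof.
elim/big_ind2 : _ => // [u m v n um vn]; lia.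
Qed.

(** Sum r k_i = N + sum over j of (k_i - k_j) in absolute value over i; each pair is met twice.
    Decay in N and in the differences thus gives decay in all coordinates. *)
Lemma l1_le_pairs r (k : {ffun 'I_r -> int}) : (0 < r)%N ->
  (l1 k <= `|ksum k| +
    2 * (\sum_(i < r) \sum_(j < r | i < j) `|k i - k j|))%N.
Proof.
move=> r0; set P := (\sum_(i < r) \sum_(j < r | _) _)%N.
have h i : (r * `|k i| <= `|ksum k| + \sum_(j < r) `|k i - k j|)%N.
  have e : r%:Z * k i = ksum k + \sum_(j < r) (k i - k j).
    rewrite big_split /= sumrN sumr_const card_ord -mulr_natl natz /ksum.
    by ring.
  have tri := absz_sum (fun j => k i - k j).
  have : (absz (r%:Z * k i)%R <= `|ksum k| + absz (\sum_(j < r) (k i - k j))%R)%N.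
    by rewrite e; lia.
  by rewrite abszM /= => h4; exact: leq_trans h4 (leq_add (leqnn _) tri).
have h2 : (\sum_(i < r) \sum_(j < r) `|k i - k j|)%N = (2 * P)%N.
  rewrite big_pairs big1 /= ?add0n => [|i _]; last by rewrite subrr.
  rewrite /P big_distrr /=; apply: eq_bigr => i _.
  rewrite big_distrr /=; apply: eq_bigr => j _.
  by move: (k i) (k j) => u v; lia.
have h3 : (r * l1 k <= r * `|ksum k| + 2 * P)%N.
  rewrite -h2 /l1 big_distrr /= -[r in (r * `|ksum k|)%N]card_ord -sum_nat_const.
  by rewrite -big_split /=; apply: leq_sum => i _; exact: h.
rewrite -(leq_pmul2l r0) mulnDr; apply: (leq_trans h3).
by rewrite leq_add2l leq_pmull.
Qed.

(** * Bounds for the pair factors and the box factor *)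

Section TermBounds.

Variables (R : realType) (q : R[i]).
Hypotheses (q_neq0 : q != 0) (q_lt1 : nrm q < 1).

Let Q := nrm q.
Let Q0 : 0 < Q := nrm_gt0 q_neq0.
Let E := qexp_bound q.
Let E_gt0 t : 0 < E t := qexp_bound_gt0 q t.
Let QX_le1 n : Q ^+ n <= 1. Proof. by rewrite exprn_ile1 // ltW. Qed.
Let QX_ge0 n : 0 <= Q ^+ n. Proof. by rewrite exprn_ge0 // ltW. Qed.

(** Each (s/t) Q^j is at most 1 + (s/t) Q^j, and products of the latter stay bounded: Gaussian decay
    beats every rate t, however small. *)
Lemma gauss_le (s t : R) n : 0 <= s -> 0 < t ->
  s ^+ n * Q ^+ 'C(n, 2) <= E (s / t) * t ^+ n.
Proof.
move=> s0 t0.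
have st : 0 <= s / t by rewrite divr_ge0 // ltW.
have -> : s ^+ n * Q ^+ 'C(n, 2) = (\prod_(j < n) (s / t * Q ^+ j)) * t ^+ n.
  rewrite -bin2_sum big_mkord expr_sum big_split /= prodr_const card_ord.
  by rewrite mulrAC -exprMn divfK // gt_eqF.
rewrite ler_wpM2r ?exprn_ge0 ?(ltW t0) //.
apply: le_trans (prod1D_le q_lt1 n st); apply: ler_prod => j _.
by rewrite mulr_ge0 //= lerDr ler01.
Qed.

(** The excess of the factors over t is summable, so it costs only a constant. *)
Lemma prod_perturb_le (f : nat -> R[i]) (t c : R) n : 0 < t -> 0 <= c ->
  (forall j, (j < n)%N -> nrm (f j) <= t + c * Q ^+ j) ->
  nrm (\prod_(j < n) f j) <= E (c / t) * t ^+ n.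
Proof.
move=> t0 c0 hf.
have ct : 0 <= c / t by rewrite divr_ge0 // ltW.
rewrite nrm_prod.
apply: (@le_trans _ _ (\prod_(j < n) ((1 + c / t * Q ^+ j) * t))).
  apply: ler_prod => j _; rewrite nrm_ge0 /=.
  apply: le_trans (hf j (ltn_ord j)) _; rewrite mulrDl mul1r mulrAC divfK //.
  by rewrite gt_eqF.
rewrite big_split /= prodr_const card_ord ler_wpM2r ?exprn_ge0 ?(ltW t0) //.
exact: prod1D_le.
Qed.

(** One exponential for each sign of d. *)
Definition pair_const (u v : R[i]) (t : R) : R :=
  (nrm u + nrm v) / nrm (u - v) *
  (E (nrm u / nrm v / t) + E (nrm v / nrm u / t)).

Lemma nrm_pair_factor (u v : R[i]) (t : R) (d : int) :
  u != 0 -> v != 0 -> u != v -> 0 < t ->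
  nrm (pair_factor q u v d) <= pair_const u v t * t ^+ `|d|%N.
Proof.
move=> u0 v0 uv t0.
have nu := nrm_gt0 u0; have nv := nrm_gt0 v0.
have nuv : 0 < nrm (u - v) by apply: nrm_gt0; rewrite subr_eq0.
have gen (s w1 : R[i]) (n : nat) : nrm w1 <= nrm u + nrm v ->
   nrm (w1 / (u - v) * s ^+ n * q ^+ 'C(n, 2)) <=
   (nrm u + nrm v) / nrm (u - v) * (E (nrm s / t) * t ^+ n).
  move=> hw; rewrite !Normc.normcM Normc.normcV !nrmX -mulrA.
  apply: ler_pM; rewrite ?mulr_ge0 ?invr_ge0 ?exprn_ge0 ?nrm_ge0 //.
    by rewrite ler_pM2r ?invr_gt0.
  exact: gauss_le (nrm_ge0 _) t0.
have A0 : 0 <= (nrm u + nrm v) / nrm (u - v).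
  by rewrite divr_ge0 ?addr_ge0 ?nrm_ge0.
case: (intP d) => [|n|n].
- have -> : pair_factor q u v 0 =
     (u * q ^+ 0 - v) / (u - v) * (u / v) ^+ 0 * q ^+ 'C(0, 2) by [].
  apply: le_trans (gen (u / v) _ 0 _) _.
    by rewrite mulr1; exact: nrmB.
  rewrite /pair_const -[leRHS]mulrA ler_wpM2l // Normc.normcM Normc.normcV.
  by rewrite ler_wpM2r ?exprn_ge0 ?(ltW t0) // lerDl ltW.
- have -> : pair_factor q u v n.+1 =
     (u * q ^+ n.+1 - v) / (u - v) * (u / v) ^+ n.+1 * q ^+ 'C(n.+1, 2).
    by rewrite /pair_factor binz2_nat.
  apply: le_trans (gen (u / v) _ n.+1 _) _.
    apply: le_trans (nrmB _ _) _; rewrite lerD2r Normc.normcM nrmX.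
    by rewrite -[leRHS]mulr1 ler_wpM2l ?nrm_ge0.
  rewrite /pair_const -[leRHS]mulrA ler_wpM2l // Normc.normcM Normc.normcV.
  by rewrite ler_wpM2r ?exprn_ge0 ?(ltW t0) // lerDl ltW.
(* For negative d, [binz2 d] exceeds (|d| choose 2) by |d|; this surplus clears q^d from the
   numerator, and the previous case recurs with the ratio u/v inverted. *)
- have -> : pair_factor q u v (- n.+1%:Z) =
     (u - v * q ^+ n.+1) / (u - v) * (v / u) ^+ n.+1 * q ^+ 'C(n.+1, 2).
    rewrite /pair_factor.
    have -> : binz2 (- n.+1%:Z) = n.+1%:Z + 'C(n.+1, 2)%:Z.
      by rewrite binz2N binS bin1 -PoszD addnC.
    have -> : (v / u) ^+ n.+1 = ((u / v) ^+ n.+1)^-1 by rewrite -exprVn invf_div.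
    rewrite expfzDr // -!exprnN -!exprnP.
    have n1 := expf_neq0 n.+1 q_neq0.
    have n2 : u - v != 0 by rewrite subr_eq0.
    have n3 : (u / v) ^+ n.+1 != 0 by rewrite expf_neq0 // mulf_neq0 ?invr_eq0.
    by field; rewrite n1 n2 n3.
  apply: le_trans (gen (v / u) _ n.+1 _) _.
    apply: le_trans (nrmB _ _) _; rewrite lerD2l Normc.normcM nrmX.
    by rewrite -[leRHS]mulr1 ler_wpM2l ?nrm_ge0.
  rewrite /pair_const -[leRHS]mulrA ler_wpM2l // Normc.normcM Normc.normcV abszN.
  by rewrite ler_wpM2r ?exprn_ge0 ?(ltW t0) // lerDr ltW.
Qed.

Variables (r : nat) (x : 'I_r -> R[i]).
Hypothesis x_neq0 : forall i, x i != 0.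

(** [box_factor] at an integer index, so that n can grow with [k] fixed. For [k] in the box the
    arguments of [absz] are nonnegative. *)
Definition boxf (n : nat) (k : 'I_r -> int) : R[i] :=
  \prod_(i < r) \prod_(j < r)
   (qpn q (absz (n%:Z + k i)) (x j / x i * q * q ^ (n%:Z - k i)) *
    qpn q (absz (n%:Z - k i)) (x i / x j * q * q ^ (n%:Z + k i))).

Lemma box_factorE n (k : {ffun 'I_r -> 'I_(n + n).+1}) :
  box_factor q x k = boxf n (boxz k).
Proof.
apply: eq_bigr => i _; apply: eq_bigr => j _; rewrite ffunE /box_shift.
have lek : (k i <= n + n)%N by rewrite -ltnS.
have -> : n%:Z + ((k i)%:Z - n%:Z) = (k i)%:Z by ring.
have -> : n%:Z - ((k i)%:Z - n%:Z) = (n + n - k i)%N%:Z by clear -lek; lia.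
by [].
Qed.

Lemma nrm_boxf n (k : 'I_r -> int) : (forall i, (`|k i| <= n)%N) ->
  nrm (boxf n k) <= \prod_(i < r) \prod_(j < r)
    (E (nrm (x j / x i)) * E (nrm (x i / x j))).
Proof.
move=> hk.
have h (w : R[i]) (m : int) : 0 <= m -> nrm (w * q * q ^ m) <= nrm w.
  case: m => // m _; rewrite -exprnP -mulrA -exprS Normc.normcM nrmX.
  by rewrite -[leRHS]mulr1 ler_wpM2l ?nrm_ge0.
rewrite nrm_prod; apply: ler_prod => i _; rewrite nrm_ge0 /=.
rewrite nrm_prod; apply: ler_prod => j _; rewrite nrm_ge0 /=.
have hi := hk i.
by rewrite Normc.normcM; apply: ler_pM; rewrite ?nrm_ge0 //;
  apply: nrm_qpn_le => //; apply: h; clear -hi; lia.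
Qed.

Lemma cvgc_boxf (k : 'I_r -> int) : cvgc (fun n => boxf n k) 1.
Proof.
have -> : 1 = \prod_(i < r) \prod_(j < r) (1 * 1) :> R[i].
  by rewrite big1 // => i _; rewrite big1 // => j _; rewrite mulr1.
apply: cvgc_prod => i _; apply: cvgc_prod => j _; apply: cvgcM.
- apply: cvgc_qpn_small => //.
  apply: (@cvgc_eventually _ (fun n => (x j / x i * q * q ^ (- k i)) * q ^+ n) _ _ 0).
    by move=> n _; rewrite -mulrA exprnP -expfzDr // [- _ + _]addrC.
  exact: cvgc_geom.
- apply: cvgc_qpn_small => //.
  apply: (@cvgc_eventually _ (fun n => (x i / x j * q * q ^ (k i)) * q ^+ n) _ _ 0).
    by move=> n _; rewrite -mulrA exprnP -expfzDr // [_ + n%:Z]addrC.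
  exact: cvgc_geom.
Qed.

End TermBounds.

(** Meant for X of order q^(-M): the power of q is shared out among the factors, each of which
    becomes bounded along with X q^M. *)
Lemma qpn_rev (F : fieldType) (q X : F) M :
  q ^+ 'C(M.+1, 2) * qpn q M X = \prod_(j < M) (q ^+ j.+1 - X * q ^+ M).
Proof.
have -> : q ^+ 'C(M.+1, 2) = \prod_(j < M) q ^+ j.+1.
  elim: M => [|M IH]; first by rewrite big_ord0 bin_small.
  by rewrite big_ord_recr /= -IH binS bin1 exprD.
rewrite /qpn [X in _ * X](reindex_inj rev_ord_inj) -big_split.
apply: eq_bigr => j _ /=; rewrite mulrBr mulr1; congr (_ - _).
rewrite mulrCA -exprD; congr (_ * _ ^+ _); have := ltn_ord j; lia.
Qed.

(** * Bound and limit of the factors depending on |k| only *)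

Section TailFactor.

Variables (R : realType) (q a b z : R[i]).
Hypotheses (q_neq0 : q != 0) (q_lt1 : nrm q < 1) (z_neq0 : z != 0).

Definition tail_factor (L : nat) (N : int) : R[i] :=
  rothe_coef q (a * q ^+ L) b (absz (L%:Z + N)) *
  qpn q (absz (L%:Z - N)) (z * (a + b * q ^ N)).

Let Q := nrm q.
Let Q0 : 0 < Q := nrm_gt0 q_neq0.
Let E := qexp_bound q.
Let E_gt0 t : 0 < E t := qexp_bound_gt0 q t.
Let QX_le1 n : Q ^+ n <= 1. Proof. by rewrite exprn_ile1 // ltW. Qed.
Let QX_ge0 n : 0 <= Q ^+ n. Proof. by rewrite exprn_ge0 // ltW. Qed.
Let QX_decr m n : (m <= n)%N -> Q ^+ n <= Q ^+ m.
Proof. by apply: ler_wiXn2l; exact: ltW. Qed.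
Let D := nrm a + nrm b.
Let D0 : 0 <= D. Proof. by rewrite addr_ge0 ?nrm_ge0. Qed.

Let lin_le (m n : nat) : nrm (a * q ^+ m + b * q ^+ n) <= D.
Proof.
apply: le_trans (nrmD _ _) _; rewrite !Normc.normcM !nrmX.
by apply: lerD; rewrite -[leRHS]mulr1 ler_wpM2l ?nrm_ge0.
Qed.

Let lin_le_z (m n : nat) : nrm (z * (a * q ^+ m + b * q ^+ n)) <= nrm z * D.
Proof. by rewrite Normc.normcM ler_wpM2l ?nrm_ge0. Qed.

Let pref_le (L : nat) : nrm (1 - a * q ^+ L - b) <= 1 + D.
Proof.
have -> : 1 - a * q ^+ L - b = 1 - (a * q ^+ L + b * q ^+ 0).
  by rewrite expr0 mulr1 opprD addrA.
by apply: le_trans (nrmB _ _) _; rewrite Normc.normc1 lerD2l.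
Qed.

Let rothe_le (L M : nat) : (M <= L)%N ->
  nrm (rothe_coef q (a * q ^+ L) b (L - M)) <= (1 + D) * E D.
Proof.
move=> ML; have [LM|LM] := eqVneq (L - M)%N 0%N.
  rewrite LM /rothe_coef Normc.normc1 -[leLHS]mulr1; apply: ler_pM => //.
    by rewrite lerDl.
  by rewrite -expR0 ler_expR divr_ge0 // subr_ge0 ltW.
have [K hK] : exists K, (L - M)%N = K.+1 by exists (L - M).-1; rewrite prednK // lt0n.
rewrite hK (@rothe_coef_shift _ _ q_neq0 _ _ _ _ (- M%:Z)); last by clear -ML hK; lia.
rewrite Normc.normcM; apply: ler_pM; rewrite ?nrm_ge0 //.
apply: nrm_qpn_le => //; have := lin_le M.+1 1.
by rewrite expr1 opprK -PoszD add1n.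
Qed.

(** The large factors are the first M of the second product if N = -M, and of the coefficient if N =
    M+1. By [qpn_rev] they merge with q^(N choose 2) z^N into factors approaching -b, respectively
    -az; all others are bounded. *)
Lemma nrm_tail_factor (t : R) : 0 < t -> nrm (a * z) <= t -> nrm b <= t ->
  exists2 C, 0 <= C & forall (L : nat) (N : int), (`|N| <= L)%N ->
    nrm (q ^ binz2 N * z ^ N * tail_factor L N) <= C * t ^+ `|N|%N.
Proof.
move=> t0 azt bt; have z0 := nrm_gt0 z_neq0; have a0 := nrm_ge0 a.
have b0 := nrm_ge0 b.
(* The j-th merged factor is at most t + c1 Q^j for N <= 0 and t + c2 Q^j for N > 0, and [W] bounds
   the rest. For N = M+1 only M factors are merged, so one z is left over and one t is missing,
   whence |z|/t. *)
pose c1 := (nrm z)^-1 + nrm a; pose c2 := nrm z * (1 + nrm b).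
have c1_ge0 : 0 <= c1 by rewrite addr_ge0 // invr_ge0 ltW.
have c2_ge0 : 0 <= c2 by rewrite mulr_ge0 ?addr_ge0 ?nrm_ge0.
pose W := (1 + D) * E D * E (nrm z * D).
have W0 : 0 <= W by rewrite !mulr_ge0 ?addr_ge0 // ltW.
have e10 : 0 <= E (c1 / t) by rewrite ltW.
have e20 : 0 <= nrm z / t * E (c2 / t) by rewrite mulr_ge0 ?divr_ge0 ?ltW.
exists (W * (E (c1 / t) + nrm z / t * E (c2 / t))).
  by rewrite mulr_ge0 // addr_ge0.
have int_cases (N : int) :
    (exists M : nat, N = - M%:Z) \/ (exists M : nat, N = M.+1%:Z).
  by case: (intP N) => [|n|n]; [left; exists 0%N|right; exists n|left; exists n.+1].
move=> L N NL; have [[M hM]|[M hM]] := int_cases N.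
- subst N; rewrite abszN /= in NL *; rewrite /tail_factor.
  have -> : absz (L%:Z + - M%:Z) = (L - M)%N by clear -NL; lia.
  have -> : absz (L%:Z - - M%:Z) = (M + L)%N by clear -NL; lia.
  rewrite qpnD; set X := z * _.
  have hX : X * q ^+ M = z * (a * q ^+ M + b * q ^+ 0).
    rewrite /X -exprnN expr0 mulr1 -mulrA mulrDl; congr (_ * (_ + _)).
    by rewrite divfK // expf_neq0.
  rewrite hX binz2N.
  have -> : q ^ 'C(M.+1, 2) * z ^ (- M%:Z) *
     (rothe_coef q (a * q ^+ L) b (L - M) *
      (qpn q M X * qpn q L (z * (a * q ^+ M + b * q ^+ 0)))) =
     rothe_coef q (a * q ^+ L) b (L - M) *
     qpn q L (z * (a * q ^+ M + b * q ^+ 0)) *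
     \prod_(j < M) ((q ^+ j.+1 - X * q ^+ M) / z).
    rewrite big_split /= -qpn_rev prodr_const card_ord exprVn -exprnN -exprnP.
    by ring.
  rewrite !Normc.normcM.
  apply: (@le_trans _ _ (W * (E (c1 / t) * t ^+ M))).
    apply: ler_pM; rewrite ?mulr_ge0 ?nrm_ge0 //.
      apply: ler_pM; rewrite ?nrm_ge0 ?rothe_le //.
      exact: nrm_qpn_le.
    apply: (@prod_perturb_le _ _ q_lt1 (fun j => (q ^+ j.+1 - X * q ^+ M) / z)) => //.
    move=> j jM; rewrite hX Normc.normcM Normc.normcV.
    rewrite ler_pdivrMr //; apply: le_trans (nrmB _ _) _.
    rewrite Normc.normcM nrmX expr0 mulr1.
    have h1 : nrm (a * q ^+ M + b) <= nrm a * Q ^+ j + t.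
      apply: le_trans (nrmD _ _) _; rewrite Normc.normcM nrmX lerD //.
      by rewrite ler_wpM2l // QX_decr // ltnW.
    have h2 : Q ^+ j.+1 <= Q ^+ j by rewrite QX_decr.
    apply: (@le_trans _ _ (Q ^+ j + nrm z * (nrm a * Q ^+ j + t))).
      by rewrite lerD // ler_wpM2l // ltW.
    rewrite /c1 le_eqVlt; apply/orP; left; apply/eqP.
    by field; rewrite gt_eqF.
  rewrite -[leRHS]mulrA ler_wpM2l // ler_wpM2r ?exprn_ge0 ?(ltW t0) //.
  by rewrite lerDl.
- subst N; rewrite /= in NL *; rewrite /tail_factor.
  have -> : absz (L%:Z + M.+1%:Z) = (M + L).+1 by clear -NL; lia.
  have -> : absz (L%:Z - M.+1%:Z) = (L - M.+1)%N by clear -NL; lia.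
  rewrite (@rothe_coef_shift _ _ q_neq0 _ _ _ _ M.+1%:Z); last by clear -NL; lia.
  rewrite qpnD; set X := a * q ^ (1 - M.+1%:Z) + b * q.
  have hX : X * q ^+ M = a * q ^+ 0 + b * q ^+ M.+1.
    rewrite /X; have -> : 1 - M.+1%:Z = - M%:Z by clear; lia.
    rewrite -exprnN expr0 mulr1 mulrDl -mulrA mulVf ?expf_neq0 // mulr1.
    by rewrite -mulrA -exprS.
  rewrite hX binz2_nat.
  have -> : q ^ 'C(M.+1, 2) * z ^ M.+1 *
     ((1 - a * q ^+ L - b) * (qpn q M X * qpn q L (a * q ^+ 0 + b * q ^+ M.+1)) *
      qpn q (L - M.+1) (z * (a + b * q ^ M.+1))) =
     (1 - a * q ^+ L - b) * qpn q L (a * q ^+ 0 + b * q ^+ M.+1) *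
     qpn q (L - M.+1) (z * (a * q ^+ 0 + b * q ^+ M.+1)) *
     (z * \prod_(j < M) (z * (q ^+ j.+1 - X * q ^+ M))).
    rewrite big_split /= -qpn_rev prodr_const card_ord -!exprnP [z ^+ M.+1]exprS.
    by rewrite expr0 mulr1; ring.
  rewrite !Normc.normcM.
  apply: (@le_trans _ _ (W * (nrm z * (E (c2 / t) * t ^+ M)))).
    apply: ler_pM; rewrite ?mulr_ge0 ?nrm_ge0 //.
      apply: ler_pM; rewrite ?mulr_ge0 ?nrm_ge0 //; last exact: nrm_qpn_le.
      by apply: ler_pM; rewrite ?nrm_ge0 //; exact: nrm_qpn_le.
    rewrite ler_wpM2l ?nrm_ge0 //.
    apply: (@prod_perturb_le _ _ q_lt1 (fun j => z * (q ^+ j.+1 - X * q ^+ M))) => //.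
    move=> j jM; rewrite hX expr0 mulr1.
    have -> : z * (q ^+ j.+1 - (a + b * q ^+ M.+1)) =
       z * (q ^+ j.+1 - b * q ^+ M.+1) - a * z by ring.
    apply: le_trans (nrmB _ _) _; rewrite addrC lerD // Normc.normcM /c2 -mulrA.
    rewrite ler_wpM2l ?nrm_ge0 // mulrDl mul1r; apply: le_trans (nrmB _ _) _.
    rewrite Normc.normcM !nrmX lerD ?QX_decr // ler_wpM2l // QX_decr //; clear -jM; lia.
  rewrite -[leRHS]mulrA ler_wpM2l // exprS.
  have -> : nrm z * (E (c2 / t) * t ^+ M) = nrm z / t * E (c2 / t) * (t * t ^+ M).
    by field; rewrite gt_eqF.
  by rewrite ler_wpM2r ?mulr_ge0 ?exprn_ge0 ?(ltW t0) // lerDr.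
Qed.

Lemma cvgc_tail_factor r (N : int) : (0 < r)%N ->
  cvgc (fun n => tail_factor (r * n) N)
    ((1 - b) * qpoch q (a * q ^ (1 - N) + b * q) *
     qpoch q (z * (a + b * q ^ N))).
Proof.
move=> r0; have rn n : (n <= r * n)%N by rewrite leq_pmull.
apply: cvgcM; last first.
  apply: (@cvgc_comp _ (fun m => qpn q m _) _ _ `|N|%N); last exact: cvgc_qpn.
  by move=> n; have := rn n; clear; lia.
(* The coefficient of index K+1 carries a product of length K; the predecessor is genuine once n >
   |N|. *)
pose K n := (absz ((r * n)%N%:Z + N)).-1.
apply: (@cvgc_eventually _ (fun n => (1 - a * q ^+ (r * n) - b) *
   qpn q (K n) (a * q ^ (1 - N) + b * q)) _ _ (`|N|%N.+1)).
  move=> n Nn; have hn := rn n.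
  have -> : absz ((r * n)%N%:Z + N) = (K n).+1 by rewrite /K; clear -Nn hn; lia.
  by rewrite (@rothe_coef_shift _ _ q_neq0 _ _ _ _ N) // /K; clear -Nn hn; lia.
apply: cvgcM; last first.
  apply: (@cvgc_comp _ (fun m => qpn q m _) _ _ (`|N|%N.+1)); last exact: cvgc_qpn.
  by move=> n; have := rn n; rewrite /K; clear; lia.
have -> : 1 - b = (1 + 0) + - b by rewrite addr0.
apply: cvgcD; last exact: cvgc_cst.
apply: cvgcD; first exact: cvgc_cst.
apply: (@cvgc_eventually _ (fun n => (- a) * q ^+ (r * n)) _ _ 0).
  by move=> n _; rewrite mulNr.
apply: (@cvgc_comp _ (fun m => - a * q ^+ m) _ _ 0); last exact: cvgc_geom.
by move=> n; rewrite addn0.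
Qed.

End TailFactor.

(** * The terms of the finite identity: sum, limit and domination *)

Section ApproxTerm.

Variables (R : realType) (q a b z : R[i]) (r : nat) (x : 'I_r -> R[i]).
Hypotheses (q_neq0 : q != 0) (q_lt1 : nrm q < 1) (z_neq0 : z != 0).
Hypotheses (r_gt0 : (0 < r)%N) (x_neq0 : forall i, x i != 0).

Definition approx_term (n : nat) (k : {ffun 'I_r -> int}) : R[i] :=
  theta_weight q x k * (-1) ^ (r%:Z * ksum k) * z ^ ksum k *
  boxf q x n k * tail_factor q a b z (r * n) (ksum k).

Lemma sum_approx_term n :
  (forall i j (s t : nat), i != j -> x i * q ^+ s != x j * q ^+ t) ->
  \sum_(k <- boxset r n) approx_term n k =
  (\prod_(i < r) \prod_(j < r) qpn q (n + n) (x i / x j * q)) *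
  (qpn q (r * n) z * qpn q (r * n) (q / z)).
Proof.
move=> x_gen.
have q_aper m : 1 - q ^+ m.+1 != 0.
  rewrite subr_eq0; apply/eqP => /(congr1 (@Normc.normc R)).
  rewrite Normc.normc1 nrmX => /eqP; rewrite eq_sym => /eqP h.
  have : nrm q ^+ m.+1 < 1 by rewrite exprn_ilt1 ?nrm_ge0.
  by rewrite h ltxx.
rewrite -(bilateral_finite q_neq0 q_aper n x_neq0 x_gen a b z_neq0) sum_boxset.
apply: eq_bigr => k _.
have e : boxz k = box_shift k :> ('I_r -> int).
  by apply/funext => i; rewrite ffunE.
have eN : ksum (boxz k) = \sum_(i < r) box_shift k i by rewrite /ksum e.
have kle : (\sum_(i < r) k i <= r * (n + n))%N.
  rewrite -[r in (r * _)%N]card_ord -sum_nat_const; apply: leq_sum => i _.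
  by rewrite -ltnS.
rewrite /approx_term /tail_factor -(box_factorE q x k) eN e.
congr (_ * (rothe_coef q _ b _ * qpn q _ _)); rewrite sum_box_shift;
  move: kle; move: (\sum_(i < r) k i)%N => K; clear; lia.
Qed.

Lemma cvgc_approx_term (k : {ffun 'I_r -> int}) :
  cvgc (fun n => approx_term n k)
   (theta_weight q x k * (-1) ^ (r%:Z * ksum k) * z ^ ksum k * 1 *
    ((1 - b) * qpoch q (a * q ^ (1 - ksum k) + b * q) *
     qpoch q (z * (a + b * q ^ ksum k)))).
Proof.
apply: cvgcM; last exact: cvgc_tail_factor.
by apply: cvgcM; [exact: cvgc_cst | exact: cvgc_boxf].
Qed.

Lemma nrm_approx_term (rho : R) : 0 < rho < 1 ->
  nrm (a * z) <= rho ^+ 2 -> nrm b <= rho ^+ 2 ->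
  (forall i j, i != j -> x i != x j) ->
  exists2 C, 0 <= C & forall n (k : {ffun 'I_r -> int}),
    (forall i, (`|k i| <= n)%N) ->
    nrm (approx_term n k) <= C * rho ^+ (2 * l1 k).
Proof.
move=> /andP[rho0 rho1] haz hb x_inj.
have t0 : 0 < rho ^+ 2 by rewrite exprn_gt0.
(* The rate rho^2 in |k| is dictated by |az| and |b|. The rate for the pairs is free, and rho^4
   matches the coefficient 2 in [l1_le_pairs]. *)
have s0 : 0 < rho ^+ 4 by rewrite exprn_gt0.
have [C1 C1_ge0 hC1] := nrm_tail_factor q_neq0 q_lt1 z_neq0 t0 haz hb.
pose C2 := \prod_(i < r) \prod_(j < r)
  (qexp_bound q (nrm (x j / x i)) * qexp_bound q (nrm (x i / x j))).
pose C3 := \prod_(i < r) \prod_(j < r | (i < j)%N) pair_const q (x i) (x j) (rho ^+ 4).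
have C2_ge0 : 0 <= C2.
  apply: prodr_ge0 => i _; apply: prodr_ge0 => j _.
  by rewrite mulr_ge0 // ltW // qexp_bound_gt0.
have C3_ge0 : 0 <= C3.
  apply: prodr_ge0 => i _; apply: prodr_ge0 => j _.
  by rewrite mulr_ge0 ?divr_ge0 ?addr_ge0 ?nrm_ge0 // ltW // qexp_bound_gt0.
exists (C3 * C2 * C1); first by rewrite !mulr_ge0.
move=> n k hk.
set P := (\sum_(i < r) \sum_(j < r | (i < j)%N) absz (k i - k j)%R)%N.
have h3 : nrm (\prod_(i < r) \prod_(j < r | (i < j)%N)
    pair_factor q (x i) (x j) (k i - k j)) <= C3 * (rho ^+ 4) ^+ P.
  rewrite /P expr_sum -big_split nrm_prod; apply: ler_prod => i _.
  rewrite nrm_ge0 /= expr_sum -big_split nrm_prod; apply: ler_prod => j ij.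
  rewrite nrm_ge0 /=; apply: nrm_pair_factor => //.
  by apply: x_inj; rewrite -val_eqE neq_ltn ij.
have h2 : nrm (boxf q x n k) <= C2 by exact: nrm_boxf.
have Nrn : (`|ksum k| <= r * n)%N.
  rewrite -[r in (r * n)%N]card_ord -sum_nat_const /ksum.
  by apply: (leq_trans (absz_sum _)); apply: leq_sum => i _; exact: hk.
have h1 := hC1 (r * n)%N (ksum k) Nrn.
rewrite /approx_term theta_weight_pairs // -/(ksum k).
set X := \prod_(i < r) _ in h3 *; set Y := boxf q x n k in h2 *.
set T := tail_factor _ _ _ _ _ _ in h1 *.
have -> : q ^ binz2 (ksum k) * X * (-1) ^ (r%:Z * ksum k) * z ^ ksum k * Y * T =
   (-1) ^ (r%:Z * ksum k) * (X * Y * (q ^ binz2 (ksum k) * z ^ ksum k * T)).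
  by ring.
rewrite Normc.normcM nrmXz nrmN Normc.normc1 exp1rz mul1r !Normc.normcM.
apply: (@le_trans _ _ (C3 * (rho ^+ 4) ^+ P * C2 * (C1 * (rho ^+ 2) ^+ `|ksum k|%N))).
  rewrite -!Normc.normcM.
  rewrite [nrm (X * Y * _)]Normc.normcM [nrm (X * Y)]Normc.normcM.
  apply: ler_pM; rewrite ?mulr_ge0 ?nrm_ge0 //.
  by apply: ler_pM; rewrite ?nrm_ge0.
have -> : C3 * (rho ^+ 4) ^+ P * C2 * (C1 * (rho ^+ 2) ^+ `|ksum k|%N) =
    C3 * C2 * C1 * rho ^+ (2 * (`|ksum k| + 2 * P)).
  rewrite mulnDr mulnA exprD -!exprM; ring.
rewrite ler_wpM2l ?mulr_ge0 //.
apply: ler_wiXn2l; rewrite ?(ltW rho0) ?(ltW rho1) //.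
by rewrite leq_pmul2l // l1_le_pairs.
Qed.

End ApproxTerm.

(** * The degenerate case: two x_i on the same q-orbit *)

Section Degenerate.

Variables (F : fieldType) (q : F) (r : nat) (x : 'I_r -> F).
Hypotheses (q_neq0 : q != 0) (x_neq0 : forall i, x i != 0).
Variables (i j : 'I_r) (l : int).
Hypotheses (ij : i != j) (xij : x i = x j * q ^ l).

(* Exchanges the values of x_i q^(k_i) and x_j q^(k_j). *)
Definition swap_exponents (k : {ffun 'I_r -> int}) : {ffun 'I_r -> int} :=
  [ffun m => if m == i then k j - l else if m == j then k i + l else k m].

Let ji : j != i. Proof. by rewrite eq_sym. Qed.

Lemma swap_exponentsK : involutive swap_exponents.
Proof.
move=> k; apply/ffunP => m; rewrite !ffunE !eqxx (negbTE ji).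
case: eqVneq => [->|mi]; first by rewrite addrK.
by case: eqVneq => [->|mj]; first by rewrite subrK.
Qed.

Lemma sum_swap_exponents (f : int -> int) k :
  \sum_(m < r) f (swap_exponents k m) =
  \sum_(m < r) f (k m) + (f (k j - l) + f (k i + l) - f (k i) - f (k j)).
Proof.
rewrite (bigD1 i) //= (bigD1 j) //= [X in _ = X + _](bigD1 i) //=.
rewrite [X in _ = _ + X + _](bigD1 j) //=.
rewrite !ffunE eqxx (negbTE ji) eqxx.
have -> : \sum_(m < r | (m != i) && (m != j)) f (swap_exponents k m) =
    \sum_(m < r | (m != i) && (m != j)) f (k m).
  by apply: eq_bigr => m /andP[mi mj]; rewrite ffunE (negbTE mi) (negbTE mj).
by ring.
Qed.

Lemma ksum_swap_exponents k : ksum (swap_exponents k) = ksum k.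
Proof. by rewrite /ksum (sum_swap_exponents id) /=; ring. Qed.

(** A transposition of the arguments exchanges two columns of a Vandermonde matrix; the entries are
    negated in [V] to obtain the differences in the order y_m - y_n. *)
Lemma prod_pairs_swap (y : 'I_r -> F) :
  \prod_(m < r) \prod_(n < r | (m < n)%N) (y (tperm i j m) - y (tperm i j n)) =
  - \prod_(m < r) \prod_(n < r | (m < n)%N) (y m - y n).
Proof.
pose V (y : 'I_r -> F) := Vandermonde r (\row_m - y m).
have hV w : \prod_(m < r) \prod_(n < r | (m < n)%N) (w m - w n) = \det (V w).
  rewrite det_Vandermonde; apply: eq_bigr => m _; apply: eq_bigr => n _.
  by rewrite !mxE opprK addrC.
rewrite !hV.
have -> : V (fun m => y (tperm i j m)) = V y *m perm_mx (tperm i j).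
  by rewrite -[in RHS]tpermV -col_permE; apply/matrixP => m n; rewrite !mxE.
by rewrite det_mulmx det_perm odd_tperm ij expr1 mulrN1.
Qed.

(** The sign comes from the Vandermonde numerator. The change of the q-exponent by r e is undone by
    the powers of x_i = x_j q^l and x_j. *)
Lemma theta_weight_swap k :
  theta_weight q x (swap_exponents k) = - theta_weight q x k.
Proof.
rewrite /theta_weight -!/(ksum _) ksum_swap_exponents.
have y_swap m : x m * q ^ swap_exponents k m =
    (fun m => x m * q ^ k m) (tperm i j m).
  rewrite ffunE /=; case: tpermP => [->|->|/eqP mi /eqP mj].
  - by rewrite eqxx xij -mulrA -expfzDr //; congr (_ * _ ^ _); ring.
  - by rewrite (negbTE ji) eqxx xij -mulrA -expfzDr //; congr (_ * _ ^ _); ring.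
  - by rewrite (negbTE mi) (negbTE mj).
have hV : \prod_(m < r) \prod_(n < r | (m < n)%N)
     ((x m * q ^ swap_exponents k m - x n * q ^ swap_exponents k n) / (x m - x n)) =
   - \prod_(m < r) \prod_(n < r | (m < n)%N)
     ((x m * q ^ k m - x n * q ^ k n) / (x m - x n)).
  have spl (f : 'I_r -> 'I_r -> F) : \prod_(m < r) \prod_(n < r | (m < n)%N)
      (f m n / (x m - x n)) = (\prod_(m < r) \prod_(n < r | (m < n)%N) f m n) /
      (\prod_(m < r) \prod_(n < r | (m < n)%N) (x m - x n)).
    rewrite -prodf_div; apply: eq_bigr => m _.
    by rewrite prodf_div.
  rewrite !spl -mulNr; congr (_ / _).
  rewrite -(prod_pairs_swap (fun m => x m * q ^ k m)).
  by apply: eq_bigr => m _; apply: eq_bigr => n _; rewrite !y_swap.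
rewrite hV !mulNr; congr (- _); rewrite -!mulrA; congr (_ * _).
rewrite (sum_swap_exponents binz2).
set e := binz2 (k j - l) + binz2 (k i + l) - binz2 (k i) - binz2 (k j).
have he : e = l * (k i - k j) + l * l.
  apply: (@mulfI _ (2 : int)) => //.
  by rewrite /e !mulrDr !mulrN !binz2_double; ring.
have hX : \prod_(m < r) x m ^ (r%:Z * swap_exponents k m - ksum k) =
   q ^ (- (r%:Z * e)) * \prod_(m < r) x m ^ (r%:Z * k m - ksum k).
  rewrite (bigD1 i) //= (bigD1 j) //= [X in _ = _ * X](bigD1 i) //=.
  rewrite [X in _ = _ * (_ * X)](bigD1 j) //=.
  have -> : \prod_(m < r | (m != i) && (m != j))
       x m ^ (r%:Z * swap_exponents k m - ksum k) =
      \prod_(m < r | (m != i) && (m != j)) x m ^ (r%:Z * k m - ksum k).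
    by apply: eq_bigr => m /andP[mi mj]; rewrite ffunE (negbTE mi) (negbTE mj).
  rewrite !mulrA; congr (_ * _).
  rewrite !ffunE eqxx (negbTE ji) eqxx xij !expfzMl !exprz_exp.
  transitivity ((x j ^ (r%:Z * k i - ksum k) * x j ^ (r%:Z * k j - ksum k)) *
    (q ^ (- (r%:Z * e)) * q ^ (l * (r%:Z * k i - ksum k)))); last by ring.
  rewrite mulrAC -!expfzDr //.
  by rewrite he; congr (_ ^ _ * _ ^ _); ring.
rewrite hX mulrDr expfzDr //.
have n0 : q ^ (r%:Z * e) != 0 by rewrite expfz_neq0.
by rewrite -mulrA [q ^ (r%:Z * e) * _]mulrA -invr_expz mulfV // mul1r.
Qed.

End Degenerate.

(** * The limit and the case distinction *)

Lemma qpoch_eq0 (R : realType) (q w : R[i]) (m : nat) :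
  nrm q < 1 -> w * q ^+ m = 1 -> qpoch q w = 0.
Proof.
move=> q1 wm; apply: cvgc_unique (cvgc_qpn q1 w) _.
apply: (@cvgc_eventually _ (fun=> 0) _ _ m.+1); last exact: cvgc_cst.
by move=> n mn; rewrite /qpn (bigD1 (Ordinal mn)) //= wm subrr mul0r.
Qed.

Theorem theorem5p2 (R : realType) (r : nat) (q a b z : R[i])
    (x : 'I_r -> R[i])
    (hr : (0 < r)%N)
    (hq0 : 0 < `|q|) (hq1 : `|q| < 1)
    (hz : z <> 0) (hb : b <> 1)
    (hab : Num.max `|a * z| `|b| < 1)
    (hx0 : forall i, x i <> 0)
    (hxinj : forall i j, i <> j -> x i <> x j) :
  let term (k : {ffun 'I_r -> int}) : R[i] :=
    (\prod_(i < r) \prod_(j < r | (i < j)%N)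
       ((x i * q ^ k i - x j * q ^ k j) / (x i - x j)))
    * qpoch q (a * q ^ (1 - ksum k) + b * q)
    * qpoch q (z * (a + b * q ^ ksum k))
    * (-1) ^ (r%:Z * ksum k)
    * q ^ (r%:Z * \sum_(i < r) binz2 (k i))
    * z ^ ksum k
    * \prod_(i < r) x i ^ (r%:Z * k i - ksum k) in
  abs_summable term /\
  sums_to term
    (qpoch q z * qpoch q (q / z) / (1 - b)
     * \prod_(i < r) \prod_(j < r) qpoch q (x i / x j * q)).
Proof.
move=> term.
have q0 : q != 0 by rewrite -normr_gt0.
have q1 : nrm q < 1 by move: hq1; rewrite nrmE -[1]/(1%:C) ltcR.
have z0 : z != 0 by apply/eqP.
have b1 : 1 - b != 0 by rewrite subr_eq0; apply/eqP => /esym.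
have x0 i : x i != 0 by apply/eqP.
have xinj i j : i != j -> x i != x j by move=> /eqP ij; apply/eqP; exact: hxinj.
have [haz1 hb1] : nrm (a * z) < 1 /\ nrm b < 1.
  move: hab; rewrite /Order.max !nrmE ltcR.
  case: ltP => h; rewrite -[1]/(1%:C) ltcR => h'; split => //.
    exact: lt_trans h h'.
  exact: le_lt_trans h h'.
pose m := Num.max (nrm (a * z)) (nrm b).
have m0 : 0 <= m by rewrite le_max nrm_ge0.
have m1 : m < 1 by rewrite gt_max haz1.
(* The mean of 1 and m is positive even for m = 0, and its square is at least m. *)
pose rho := (1 + m) / 2.
have rho01 : 0 < rho < 1 by rewrite /rho; apply/andP; split; lra.
have m_le : m <= rho ^+ 2.
  have -> : rho ^+ 2 = m + ((1 - m) / 2) ^+ 2 by rewrite /rho; field.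
  by rewrite lerDl sqr_ge0.
have haz : nrm (a * z) <= rho ^+ 2 by apply: le_trans m_le; rewrite le_max lexx.
have hb2 : nrm b <= rho ^+ 2 by apply: le_trans m_le; rewrite le_max lexx orbT.
have [C C0 hC] := nrm_approx_term q0 q1 z0 hr x0 rho01 haz hb2 xinj.
pose f n k := approx_term q a b z x n k * (1 - b)^-1.
have nb : 0 < nrm (1 - b)^-1 by apply: nrm_gt0; rewrite invr_eq0.
pose C' := C * nrm (1 - b)^-1.
have C'0 : 0 <= C' by rewrite mulr_ge0 ?nrm_ge0.
have hf n (k : {ffun 'I_r -> int}) : (forall i, (`|k i| <= n)%N) ->
    nrm (f n k) <= C' * rho ^+ (2 * l1 k).
  by move=> hk; rewrite Normc.normcM /C' mulrAC ler_pM2r // hC.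
have termE k : term k = theta_weight q x k * (-1) ^ (r%:Z * ksum k) *
    z ^ ksum k * (qpoch q (a * q ^ (1 - ksum k) + b * q) *
    qpoch q (z * (a + b * q ^ ksum k))).
  by rewrite /term /theta_weight -/(ksum k); ring.
have cf k : cvgc (fun n => f n k) (term k).
  have := cvgcM (@cvgc_approx_term _ q a b z r x q0 q1 hr k)
    (cvgc_cst (1 - b)^-1).
  congr cvgc; rewrite termE.
  by field.
(* The summand inherits the bound as a limit, because k lies in the n-th box once n >= [l1 k]. This
   settles absolute convergence in both cases below. *)
have hg k : nrm (term k) <= C' * rho ^+ (2 * l1 k).
  apply: (cvgc_nrm_le (cf k)); exists (l1 k) => n kn; apply: hf => i.
  by apply: leq_trans kn; rewrite /l1 (bigD1 i) //= leq_addr.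
split; first exact: (abs_summable_dominated rho01 C'0 hg).
have [x_gen|] := pselect (forall i j (s t : nat), i != j ->
    x i * q ^+ s != x j * q ^+ t).
  pose S n := (\prod_(i < r) \prod_(j < r) qpn q (n + n) (x i / x j * q)) *
    (qpn q (r * n) z * qpn q (r * n) (q / z)) * (1 - b)^-1.
  apply: (tannery rho01 C'0 hf hg cf (S := S)).
    by move=> n; rewrite -mulr_suml sum_approx_term.
  have -> : qpoch q z * qpoch q (q / z) / (1 - b) *
      \prod_(i < r) \prod_(j < r) qpoch q (x i / x j * q) =
    (\prod_(i < r) \prod_(j < r) qpoch q (x i / x j * q)) *
    (qpoch q z * qpoch q (q / z)) * (1 - b)^-1 by ring.
  apply: cvgcM; last exact: cvgc_cst.
  have rn n : (n <= r * n + 0)%N by rewrite addn0 leq_pmull.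
  apply: cvgcM; last first.
    by apply: cvgcM; apply: (@cvgc_comp _ (fun n => qpn q n _) _ _ 0 rn);
      exact: cvgc_qpn.
  apply: cvgc_prod => i _; apply: cvgc_prod => j _.
  apply: (@cvgc_comp _ (fun n => qpn q n _) _ (fun n => n + n)%N 0); last exact: cvgc_qpn.
  by move=> n; rewrite addn0 leq_addr.
move=> ngen.
(* With i and j ordered so that l > 0, the factor of index (j, i) on the product side is
   (q^(1-l))_oo, which vanishes at its term q^(l-1). *)
have [i [j [l [ij [l_gt0 xij]]]]] : exists i j (l : nat),
    i != j /\ (0 < l)%N /\ x i = x j * q ^+ l.
  apply: contrapT => hn; apply: ngen => i j s t ij; apply/eqP => e.
  have ji : j != i by rewrite eq_sym.
  apply: hn; have [ts|st|ts] := ltngtP t s.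
  - exists j, i, (s - t)%N; rewrite ji subn_gt0; split => //; split => //.
    apply: (mulIf (expf_neq0 t q0)).
    by rewrite -mulrA -exprD subnK ?(ltnW ts).
  - exists i, j, (t - s)%N; rewrite ij subn_gt0; split => //; split => //.
    apply: (mulIf (expf_neq0 s q0)).
    by rewrite -mulrA -exprD subnK ?(ltnW st).
  - by move: (xinj _ _ ij); rewrite ts in e; rewrite (mulIf (expf_neq0 s q0) e) eqxx.
have -> : \prod_(i < r) \prod_(j < r) qpoch q (x i / x j * q) = 0.
  rewrite (bigD1 j) //= (bigD1 i) //= (@qpoch_eq0 _ q _ l.-1) ?mul0r //.
  rewrite -mulrA -exprS prednK // xij.
  by have := expf_neq0 l q0 => n0; field; rewrite x0 n0.
rewrite mulr0.
apply: (@sums_to0_involution _ _ _ rho01 _ C'0 term (swap_exponents i j l)) => //.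
  exact: swap_exponentsK.
move=> k; rewrite !termE (ksum_swap_exponents _ ij).
by rewrite (@theta_weight_swap _ q r x q0 x0 i j l%:Z ij xij) !mulNr.
Qed.
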